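(* Let $\Omega\subset\mathbb R^N$ be a bounded domain of class $C^2$, let $f\in C(\Omega)\cap L^\infty(\Omega)$, and let $s_0\in(\frac12,1)$ be the lower bound for interior Hölder regularity recalled in the context. Let $s\in(s_0,1)$ and let $\mathcal I$ be the operator of order $2s$ defined in the context. If $u$ is a viscosity solution of $$\begin{cases}\mathcal I u=f(x)&\text{in }\Omega\\ u=0&\text{in }\mathbb R^N\setminus\Omega,\end{cases}$$ then $u\in C^{0,\alpha}(\overline\Omega)$ for some $\alpha=\alpha(s)\in(0,1)$.
   Context: $\mathbb S^{N-1}$ is the unit sphere of $\mathbb R^N$ and $B_r(x)$ is the ball of radius $r$ centered at $x$. For $s\in(0,1)$ and $\xi\in\mathbb S^{N-1}$, $$\mathcal I_\xi u(x)=C_s\int_0^{+\infty}\frac{u(x+\tau\xi)+u(x-\tau\xi)-2u(x)}{\tau^{1+2s}}\,d\tau,\qquad \mathcal I u(x)=\inf_{\xi\in\mathbb S^{N-1}}\mathcal I_\xi u(x)+\sup_{\xi\in\mathbb S^{N-1}}\mathcal I_\xi u(x),$$ where $C_s>0$ is a normalizing constant such that $\lim_{s\to1^-}\mathcal I_\xi u(x)=\langle D^2u(x)\xi,\xi\rangle$ for bounded smooth $u$. The number $s_0$: it is the number in $(\frac12,1)$ provided by the following interior regularity theorem. There exists $s_0\in(\frac12,1)$ such that if $s\in(s_0,1)$, $D\subseteq\mathbb R^N$ is a domain (not necessarily bounded), $f\in C(D)$ and $u$ is a bounded viscosity solution of $\mathcal Iu=f(x)$ in $D$, then $u\in C^{0,\alpha}_{\mathrm{loc}}(D)$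 for some $\alpha=\alpha(s)\in(0,1)$; moreover, for $\omega\subset\subset\omega'\subset\subset D$, $\|u\|_{C^{0,\alpha}(\omega)}\le C$ with $C>0$ depending on $s$, $\mathrm{dist}(\omega,\partial\omega')$, $\|u\|_{L^\infty(\mathbb R^N)}$ and $\|f\|_{L^\infty(\omega')}$. Viscosity solutions (standard definition): let $u:\mathbb R^N\to\mathbb R$ be bounded, Borel measurable and continuous in $\Omega$. It is a viscosity subsolution (resp. supersolution) of $\mathcal Iu=f$ in $\Omega$ if for every $x_0\in\Omega$, every $\rho>0$ with $\overline{B_\rho(x_0)}\subset\Omega$ and every $\varphi\in C^2(\overline{B_\rho(x_0)})$ with $\varphi(x_0)=u(x_0)$ and $u\le\varphi$ (resp. $u\ge\varphi$) in $B_\rho(x_0)$, the function $\psi$ equal to $\varphi$ in $\overline{B_\rho(x_0)}$ and to $u$ elsewhere satisfies $\mathcal I\psi(x_0)\ge f(x_0)$ (resp. $\mathcal I\psi(x_0)\le f(x_0)$). A viscosity solution is both a subsolution and a supersolution. In the Dirichlet problem the condition $u=0$ in $\mathbb R^N\setminus\Omega$ holds pointwise; no continuity of $u$ across $\partial\Omega$ is assumed. *)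

(* Defs.v *)
From HB Require Import structures.
From mathcomp Require Import all_boot all_order all_algebra.
From mathcomp Require Import all_classical all_reals all_analysis.

Set Implicit Arguments.
Unset Strict Implicit.
Unset Printing Implicit Defensive.
Import Order.TTheory GRing.Theory Num.Theory.
Import numFieldTopology.Exports numFieldNormedType.Exports.

Local Open Scope classical_set_scope.
Local Open Scope ring_scope.

Section Euclidean.
Context {R : realType} {N : nat}.
Implicit Types (x y : 'rV[R]_N) (A B : set 'rV[R]_N).

(* The library norm on 'rV[R]_N is the max norm; it induces the same topology
   and the same bounded sets as [enorm], but not the same sphere or balls. *)
Definition enorm x : R := Num.sqrt (\sum_(i < N) x ord0 i ^+ 2).

Definition sphere : set 'rV[R]_N := [set xi | enorm xi = 1].

Definition eball x (r : R) : set 'rV[R]_N := [set y | enorm (y - x) < r].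

Definition eclosed_ball x (r : R) : set 'rV[R]_N :=
  [set y | enorm (y - x) <= r].

Definition boundary A : set 'rV[R]_N := closure A `\` interior A.

Definition edist A B : \bar R :=
  ereal_inf [set z | exists x y, [/\ A x, B y & z = (enorm (x - y))%:E]].

Definition compactly_contained A B : Prop :=
  compact (closure A) /\ closure A `<=` B.

Definition domain A : Prop := [/\ A !=set0, open A & connected A].

Definition borel_fun (u : 'rV[R]_N -> R) : Prop :=
  forall B : set R, measurable B -> <<s [set A : set 'rV[R]_N | open A] >> (u @^-1` B).

End Euclidean.

Section Differentiability.
Context {R : realType} {N : nat}.
Implicit Types (U : set 'rV[R]_N) (f : 'rV[R]_N -> R).

Definition partial (i : 'I_N) f : 'rV[R]_N -> R := 'D_(delta_mx ord0 i) f.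

Definition hessian f (x : 'rV[R]_N) : 'M[R]_N :=
  \matrix_(i, j) partial i (partial j f) x.

(* f is of class C^k in the open set U *)
Fixpoint Ck (k : nat) U f : Prop :=
  {within U, continuous f} /\
  if k is k'.+1 then
    forall i : 'I_N, (forall x, U x -> derivable f x (delta_mx ord0 i)) /\
                     Ck k' U (partial i f)
  else True.

Definition smooth f : Prop := forall k, Ck k setT f.

Definition extends_to_closure U f : Prop :=
  exists2 g : 'rV[R]_N -> R,
    {within closure U, continuous g} & forall x, U x -> g x = f x.

(* f belongs to C^2(closure U), for U open *)
Definition C2_closure U f : Prop :=
  [/\ Ck 2 U f,
      {within closure U, continuous f},
      (forall i, extends_to_closure U (partial i f)) &
      (forall i j, extends_to_closure U (partial i (partial j f)))].

End Differentiability.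

(* In the coordinates y *m Q, near each boundary point, Omega is the strict
   epigraph of a C^2 function of the N.-1 coordinates other than the i-th. *)
Definition C2_boundary {R : realType} {N : nat} (Omega : set 'rV[R]_N) : Prop :=
  forall z, boundary Omega z ->
  exists (r : R) (Q : 'M[R]_N) (i : 'I_N) (gamma : 'rV[R]_N.-1 -> R),
    [/\ 0 < r, Q *m Q^T = 1%:M, Ck 2 setT gamma &
        forall y, eball z r y ->
          (Omega y <-> gamma (col' i (y *m Q)) < (y *m Q) ord0 i)].

Section Holder.
Context {R : realType} {N : nat}.
Implicit Types (A : set 'rV[R]_N) (f u : 'rV[R]_N -> R).

Definition sup_norm A f : \bar R := ereal_sup [set `|f x|%:E | x in A].

Definition holder_seminorm A (alpha : R) f : \bar R :=
  ereal_sup [set z | exists x y, [/\ A x, A y, x <> y &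
                       z = (`|f x - f y| / enorm (x - y) `^ alpha)%:E]].

Definition holder_norm A (alpha : R) f : \bar R :=
  (sup_norm A f + holder_seminorm A alpha f)%E.

Definition holder A (alpha : R) f : Prop := (holder_norm A alpha f < +oo)%E.

Definition holder_loc A (alpha : R) f : Prop :=
  forall omega : set 'rV[R]_N, open omega -> compactly_contained omega A ->
    holder omega alpha f.

End Holder.

Section Operator.
Context {R : realType} {N : nat}.
Implicit Types (Omega : set 'rV[R]_N) (f u phi : 'rV[R]_N -> R).
Implicit Types (c s : R) (x xi : 'rV[R]_N).

(* c stands for the constant C_s. *)
Definition Idir c s xi u x : \bar R :=
  (c%:E * \int[lebesgue_measure]_(t in `]0%R, +oo[)
    ((u (x + t *: xi) + u (x - t *: xi) - 2 * u x) / t `^ (1 + 2 * s))%:E)%E.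

Definition Iop c s u x : \bar R :=
  (ereal_inf [set Idir c s xi u x | xi in sphere] +
   ereal_sup [set Idir c s xi u x | xi in sphere])%E.

Definition normalizing (Cs : R -> R) : Prop :=
  (forall s, 0 < s < 1 -> 0 < Cs s) /\
  (forall u x xi, smooth u -> [bounded u y | y in setT] -> sphere xi ->
     Idir (Cs s) s xi u x @[s --> 1^'-] -->
       ((xi *m hessian u x *m xi^T) ord0 ord0)%:E).

Definition glue x0 (rho : R) phi u : 'rV[R]_N -> R :=
  fun x => if enorm (x - x0) <= rho then phi x else u x.

Definition admissible Omega u : Prop :=
  [/\ [bounded u x | x in setT], borel_fun u & {within Omega, continuous u}].

Definition viscosity_subsolution c s Omega f u : Prop :=
  admissible Omega u /\
  forall x0 (rho : R) phi,
    Omega x0 -> 0 < rho -> eclosed_ball x0 rho `<=` Omega ->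
    C2_closure (eball x0 rho) phi -> phi x0 = u x0 ->
    (forall x, eball x0 rho x -> u x <= phi x) ->
    ((f x0)%:E <= Iop c s (glue x0 rho phi u) x0)%E.

Definition viscosity_supersolution c s Omega f u : Prop :=
  admissible Omega u /\
  forall x0 (rho : R) phi,
    Omega x0 -> 0 < rho -> eclosed_ball x0 rho `<=` Omega ->
    C2_closure (eball x0 rho) phi -> phi x0 = u x0 ->
    (forall x, eball x0 rho x -> phi x <= u x) ->
    (Iop c s (glue x0 rho phi u) x0 <= (f x0)%:E)%E.

Definition viscosity_solution c s Omega f u : Prop :=
  viscosity_subsolution c s Omega f u /\ viscosity_supersolution c s Omega f u.

End Operator.

(* s0 is a lower bound for interior Hölder regularity in dimension N. The
   constant K depends on s, dist(omega, boundary omega'), the sup norm of u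
   and the sup norm of f on omega' through bounds d, Mu, Mf on the last three. *)
Definition interior_holder_bound (R : realType) (N : nat) (Cs : R -> R)
    (s0 : R) : Prop :=
  forall s : R, s0 < s < 1 ->
  exists2 alpha : R, 0 < alpha < 1 &
    (forall (D : set 'rV[R]_N) (f u : 'rV[R]_N -> R),
       domain D -> {within D, continuous f} ->
       viscosity_solution (Cs s) s D f u -> holder_loc D alpha u) /\
    (forall d Mu Mf : R, 0 < d ->
       exists2 K : R, 0 < K &
       forall (D omega omega' : set 'rV[R]_N) (f u : 'rV[R]_N -> R),
         domain D -> {within D, continuous f} ->
         viscosity_solution (Cs s) s D f u ->
         open omega -> open omega' ->
         compactly_contained omega omega' -> compactly_contained omega' D ->
         (d%:E <= edist omega (boundary omega'))%E ->
         (sup_norm setT u <= Mu%:E)%E -> (sup_norm omega' f <= Mf%:E)%E ->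
         (holder_norm omega alpha u <= K%:E)%E).

(* Main.v *)
(** Boundary decay. Let z lie outside Omega and compare u with the barrier
    w(x) = C |x - z|^b. If S = sup (u - w) > 0, take an almost maximum point x1,
    and let x2 maximize u - w minus a small paraboloid centered at x1 over a ball
    around x1 whose radius r is comparable to the distance to the complement. As
    |x - z|^b is a concave function of |x - z|^2, u is touched from above at x2 by
    a quadratic polynomial, and all second differences at x2 are at most
    (2 C b |x2 - z|^b + O(eps S)) min((t/r)^2, t/r); this is integrable against
    t^(-1-2s) because 1/2 < s < 1. In one direction the ray from x2 leaves Omega
    at distance comparable to r, where u vanishes, which contributes
    - u(x2) r^(-2s) up to a universal factor. For b and eps small this makes
    inf + sup of the directional operators less than f(x2). Taking the almost
    maximum relative to S is what makes continuity of u across the boundary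
    unnecessary, and b depends on s only: near the boundary of a C^1 domain the
    ray can be taken against the gradient of a local defining function, which
    makes the comparability constants universal.

    Conclusion. For |x - y| = r small, either the ball of radius sqrt r around x
    lies in Omega and the interior estimate, rescaled by sqrt r, gives a bound by
    (r / sqrt r)^a; or both points are within 2 sqrt r of the complement, and the
    boundary decay gives a bound by (sqrt r)^b. *)

Require Import Defs.
From HB Require Import structures.
From mathcomp Require Import all_boot all_order all_algebra.
From mathcomp Require Import all_classical all_reals all_analysis.
From mathcomp Require Import measurable_realfun ring lra.
Import Order.TTheory GRing.Theory Num.Theory.
Import numFieldTopology.Exports numFieldNormedType.Exports.
Set Implicit Arguments.
Unset Strict Implicit.
Unset Printing Implicit Defensive.
Local Open Scope classical_set_scope.
Local Open Scope ring_scope.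

(** * Euclidean norm *)

Section EuclideanNorm.
Context {R : realType} {N : nat}.
Implicit Types (x y z v : 'rV[R]_N) (r : R).

Definition dot x y : R := \sum_(i < N) x ord0 i * y ord0 i.

Lemma dotC x y : dot x y = dot y x.
Proof. by apply: eq_bigr => i _; rewrite mulrC. Qed.

Lemma dotDl x y z : dot (x + y) z = dot x z + dot y z.
Proof. by rewrite -big_split; apply: eq_bigr => i _; rewrite mxE mulrDl. Qed.

Lemma dotZl (a : R) x y : dot (a *: x) y = a * dot x y.
Proof. by rewrite mulr_sumr; apply: eq_bigr => i _; rewrite mxE mulrA. Qed.

Lemma dotDr x y z : dot x (y + z) = dot x y + dot x z.
Proof. by rewrite !(dotC x) dotDl. Qed.

Lemma dotZr (a : R) x y : dot x (a *: y) = a * dot x y.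
Proof. by rewrite !(dotC x) dotZl. Qed.

Lemma dotNl x y : dot (- x) y = - dot x y.
Proof. by rewrite -scaleN1r dotZl mulN1r. Qed.

Lemma dotNr x y : dot x (- y) = - dot x y.
Proof. by rewrite !(dotC x) dotNl. Qed.

Lemma dot_ge0 x : 0 <= dot x x.
Proof. by apply: sumr_ge0 => i _; rewrite -expr2 sqr_ge0. Qed.

Lemma enormE x : enorm x = Num.sqrt (dot x x).
Proof. by congr Num.sqrt; apply: eq_bigr => i _; rewrite expr2. Qed.

Lemma enorm_ge0 x : 0 <= enorm x.
Proof. by rewrite sqrtr_ge0. Qed.

Lemma sqr_enorm x : enorm x ^+ 2 = dot x x.
Proof. by rewrite enormE sqr_sqrtr ?dot_ge0. Qed.

Lemma dot0_eq0 x : dot x x = 0 -> x = 0.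
Proof.
move=> x0; apply/rowP => i; rewrite mxE; apply/eqP; rewrite -sqrf_eq0 expr2.
move/eqP: x0; rewrite psumr_eq0 => [/allP/(_ i)|j _]; last by rewrite -expr2 sqr_ge0.
by rewrite mem_index_enum => /(_ isT).
Qed.

Lemma enorm0 : enorm (0 : 'rV[R]_N) = 0.
Proof. by rewrite enormE -[X in dot X _](scale0r 0) dotZl mul0r sqrtr0. Qed.

Lemma enorm_eq0 x : enorm x = 0 -> x = 0.
Proof. by move=> x0; apply: dot0_eq0; rewrite -sqr_enorm x0 expr2 mul0r. Qed.

Lemma enorm_gt0 x : (0 < enorm x) = (x != 0).
Proof.
rewrite lt_def enorm_ge0 andbT; apply/idP/idP; apply: contra => /eqP.
  by move=> ->; rewrite enorm0.
by move=> /enorm_eq0 ->.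
Qed.

Lemma enormZ (a : R) x : enorm (a *: x) = `|a| * enorm x.
Proof.
by rewrite !enormE dotZl dotZr mulrA -expr2 sqrtrM ?sqr_ge0// sqrtr_sqr.
Qed.

Lemma enormN x : enorm (- x) = enorm x.
Proof. by rewrite -scaleN1r enormZ normrN normr1 mul1r. Qed.

Lemma enormBC x y : enorm (x - y) = enorm (y - x).
Proof. by rewrite -enormN opprB. Qed.

(** Cauchy-Schwarz, from the nonnegative square of [dot y y *: x - dot x y *: y]. *)
Lemma dot_le_enorm x y : `|dot x y| <= enorm x * enorm y.
Proof.
have [->|y0] := eqVneq y 0.
  by rewrite enorm0 mulr0 -(scale0r 0) dotZr mul0r normr0.
have dy : 0 < dot y y by rewrite -sqr_enorm exprn_gt0// enorm_gt0.
rewrite -ler_sqr ?nnegrE ?mulr_ge0 ?enorm_ge0 ?normr_ge0//.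
rewrite exprMn !sqr_enorm real_normK ?num_real// -subr_ge0 -(pmulr_rge0 _ dy).
have := dot_ge0 (dot y y *: x - dot x y *: y).
by rewrite !(dotDl, dotDr, dotNl, dotNr, dotZl, dotZr) (dotC y x); lra.
Qed.

Lemma enormD x y : enorm (x + y) <= enorm x + enorm y.
Proof.
rewrite -ler_sqr ?nnegrE ?addr_ge0 ?enorm_ge0//.
rewrite sqr_enorm sqrrD !sqr_enorm !(dotDl, dotDr) (dotC y x).
have := le_trans (ler_norm _) (dot_le_enorm x y); lra.
Qed.

Lemma enorm_triangle y x z : enorm (x - z) <= enorm (x - y) + enorm (y - z).
Proof. by rewrite -[x - z](subrKA y) enormD. Qed.

Lemma mxnorm_le_enorm x : `|x| <= enorm x.
Proof.
rewrite [leLHS]/Num.Def.normr/=.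
have [->|/mx_norm_neq0[[i j] ->]] := eqVneq (mx_norm x) 0.
  exact: enorm_ge0.
rewrite /= (ord1 i).
rewrite -ler_sqr ?nnegrE ?enorm_ge0 ?normr_ge0// real_normK ?num_real//.
rewrite sqr_enorm /dot (bigD1 j)//= -expr2 lerDl.
by apply: sumr_ge0 => k _; rewrite -expr2 sqr_ge0.
Qed.

Lemma coord_le_mxnorm x i : `|x ord0 i| <= `|x|.
Proof.
rewrite [leRHS]/Num.Def.normr/= mx_normrE.
by apply: le_trans (le_bigmax _ _ (ord0, i)).
Qed.

Lemma enorm_le_mxnorm x : enorm x <= N%:R * `|x|.
Proof.
rewrite -ler_sqr ?nnegrE ?enorm_ge0 ?mulr_ge0//.
rewrite sqr_enorm exprMn /dot.
apply: (@le_trans _ _ (\sum_(i < N) `|x| ^+ 2)).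
  apply: ler_sum => i _; rewrite -expr2 -(@real_normK _ (x _ _)) ?num_real//.
  by rewrite ler_sqr ?nnegrE ?coord_le_mxnorm.
rewrite sumr_const card_ord -[leLHS]mulr_natl.
apply: ler_wpM2r; first exact: sqr_ge0.
by rewrite -natrX ler_nat; case: (N) => // n; rewrite expnS leq_pmulr.
Qed.

(** Bridges the library topology, given by the max norm, and Euclidean balls: the two norms differ
    by a factor of at most [N]. The [+ 1] keeps the divisor of the radius positive even for
    [N = 0]. *)
Lemma nbhs_eball x (A : set 'rV[R]_N) :
  nbhs x A <-> exists2 r, 0 < r & eball x r `<=` A.
Proof.
split.
  move=> /nbhs_ballP[r /= r0 rA]; exists r => // y xy; apply: rA.
  rewrite mx_norm_ball /ball_/=; apply: le_lt_trans xy.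
  by rewrite -opprB normrN mxnorm_le_enorm.
move=> [r r0 rA]; apply/nbhs_ballP; exists (r / (N%:R + 1)) => /=.
  by rewrite divr_gt0// ltr_wpDl.
move=> y; rewrite mx_norm_ball /ball_/= => xy; apply: rA.
rewrite /eball/=; have := enorm_le_mxnorm (y - x).
rewrite -[`|y - x|]normrN opprB.
move: xy; rewrite ltr_pdivlMr ?ltr_wpDl//.
have : (0:R) <= N%:R by []. have := normr_ge0 (x - y); nra.
Qed.

Lemma eball_center x r : 0 < r -> eball x r x.
Proof. by rewrite /eball/= subrr enorm0. Qed.

Lemma nbhs_eballx x r : 0 < r -> nbhs x (eball x r).
Proof. by move=> r0; apply/nbhs_eball; exists r. Qed.

Lemma eball_open x r : open (eball x r).
Proof.
rewrite openE => y xy; apply/nbhs_eball; exists (r - enorm (y - x)).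
  by rewrite subr_gt0.
by move=> w; rewrite /eball/= => yw; have := enorm_triangle y w x; lra.
Qed.

Lemma eclosed_ball_closed x r : closed (eclosed_ball x r).
Proof.
rewrite -openC openE => y /= /negP; rewrite -ltNge => xy.
apply/nbhs_eball; exists (enorm (y - x) - r); first by rewrite subr_gt0.
move=> w /= yw; apply/negP; rewrite -ltNge.
have := enorm_triangle w y x; rewrite (enormBC y w); move: yw; rewrite /eball/=; lra.
Qed.

Lemma closure_eball x r : closure (eball x r) `<=` eclosed_ball x r.
Proof.
have /closure_id e := @eclosed_ball_closed x r.
rewrite e; apply: closureS => y; rewrite /eball /eclosed_ball /=; exact: ltW.
Qed.

Lemma bounded_set_enorm (A : set 'rV[R]_N) (M : R) :
  (forall x, A x -> enorm x <= M) -> bounded_set A.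
Proof.
move=> AM; exists M; split; first exact: num_real.
move=> B MB x /AM xM; apply: le_trans (mxnorm_le_enorm x) _.
exact: le_trans xM (ltW MB).
Qed.

Lemma eclosed_ball_compact x r : compact (eclosed_ball x r).
Proof.
apply: bounded_closed_compact; last exact: eclosed_ball_closed.
apply: (@bounded_set_enorm _ (r + enorm x)) => y; rewrite /eclosed_ball/= => yr.
by have := enormD (y - x) x; rewrite subrK; lra.
Qed.

Lemma compact_closure_eball x r : compact (closure (eball x r)).
Proof.
apply: subclosed_compact.
- exact: closed_closure.
- exact: (@eclosed_ball_compact x r).
- exact: closure_eball.
Qed.

Lemma continuous_enorm_sub z : continuous (fun x => enorm (x - z)).
Proof.
move=> x; apply/(@cvgrPdist_lt _ _ _ (nbhs x) (nbhs_filter x)) => e e0.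
near=> y.
have xy : enorm (y - x) < e by near: y; exact: nbhs_eballx.
rewrite ltr_norml; have := enorm_triangle y x z; have := enorm_triangle x y z.
by rewrite (enormBC x y); lra.
Unshelve. all: by end_near. Qed.

End EuclideanNorm.

(** * Integrals over the half-line *)

Section MonotoneIntegral.
Local Open Scope ereal_scope.
Context d (T : measurableType d) (R : realType).
Variable mu : {measure set T -> \bar R}.
Implicit Types (D : set T) (f g : T -> \bar R).

(* No measurability is needed: both sides are suprema over simple functions. *)
Lemma ge0_le_integral_nonmeasurable D f g :
  (forall x, D x -> 0 <= f x) -> (forall x, D x -> f x <= g x) ->
  \int[mu]_(x in D) f x <= \int[mu]_(x in D) g x.
Proof.
move=> f0 fg; have g0 x : D x -> 0 <= g x.
  by move=> Dx; exact: le_trans (f0 _ Dx) (fg _ Dx).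
rewrite !ge0_integralE//; apply: le_ereal_sup => _ [h hf <-]; exists h => // x.
apply: le_trans (hf x) _; rewrite /patch; case: ifPn => // /set_mem; exact: fg.
Qed.

Lemma le_integral_nonmeasurable D f g : (forall x, D x -> f x <= g x) ->
  \int[mu]_(x in D) f x <= \int[mu]_(x in D) g x.
Proof.
move=> fg; rewrite integralE [leRHS]integralE leeB//.
- apply: ge0_le_integral_nonmeasurable => // x /mem_set.
  by apply: funepos_le => y /set_mem; exact: fg.
- apply: ge0_le_integral_nonmeasurable => // x /mem_set.
  by apply: funeneg_le => y /set_mem; exact: fg.
Qed.

(** The finite positive part of [g] bounds that of [f]. This excludes the case where both parts of
    [f] have infinite integral: [+oo - +oo] is [-oo], so [f] and [- f] would both integrate to [-oo]
    and the sign could not leave the integral. *)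
Lemma le_integralN_nonmeasurable D f g :
  \int[mu]_(x in D) g^\+ x < +oo -> (forall x, D x -> f x <= g x) ->
  - (\int[mu]_(x in D) g x) <= \int[mu]_(x in D) - f x.
Proof.
move=> goo fg.
have fgp : \int[mu]_(x in D) f^\+ x <= \int[mu]_(x in D) g^\+ x.
  apply: ge0_le_integral_nonmeasurable => // x /mem_set.
  by apply: funepos_le => y /set_mem; exact: fg.
have ffin : \int[mu]_(x in D) f^\+ x \is a fin_num.
  by rewrite ge0_fin_numE ?integral_ge0//; exact: le_lt_trans goo.
rewrite integralN; last by rewrite fin_num_adde_defr.
by rewrite leeN2 le_integral_nonmeasurable.
Qed.

(** A finite positive factor preserves both infinities, and [+oo - +oo] is [-oo] by convention on
    either side. *)
Lemma gt0_muleDr (k : R) (x y : \bar R) : (0 < k)%R ->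
  k%:E * (x + y) = k%:E * x + k%:E * y.
Proof.
move=> k0; have [xfin|] := boolP (x \is a fin_num).
  by rewrite muleDr// fin_num_adde_defr.
rewrite fin_numE negb_and !negbK => /orP[] /eqP ->.
  by rewrite addNye gt0_muleNy ?lte_fin// addNye.
case: y => [y| |].
- by rewrite addye// gt0_muley ?lte_fin// -EFinM addye.
- by rewrite addye// gt0_muley ?lte_fin.
- by rewrite addeNy gt0_muleNy ?lte_fin// addeNy.
Qed.

Import HBNNSimple.

(** If a simple function [h] lies below [k * f], then [k^-1 * h] lies below [f]; linearity of the
    integral is applied to the measurable [h] alone. *)
Let ge0_integralZl_le f (k : R) : (0 < k)%R -> (forall x, 0 <= f x) ->
  \int[mu]_x (k%:E * f x) <= k%:E * \int[mu]_x f x.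
Proof.
move=> k0 f0; rewrite ge0_integralTE; last by move=> x; rewrite mule_ge0// lee_fin ltW.
apply: ge_ereal_sup => _ [h hf <-].
have mh : measurable_fun setT (EFin \o h) by exact/measurable_EFinP.
rewrite -integralT_nnsfun -lee_pdivrMl// -ge0_integralZl//; last 2 first.
- by move=> x _; rewrite lee_fin.
- by rewrite lee_fin invr_ge0 ltW.
apply: ge0_le_integral_nonmeasurable => x _.
  by rewrite -EFinM lee_fin mulr_ge0// invr_ge0 ltW.
by rewrite lee_pdivrMl.
Qed.

Lemma ge0_integralZl_nonmeasurable D f (k : R) : (0 < k)%R ->
  (forall x, D x -> 0 <= f x) ->
  \int[mu]_(x in D) (k%:E * f x) = k%:E * \int[mu]_(x in D) f x.
Proof.
move=> k0 f0; rewrite integral_mkcond erestrict_scale [in RHS]integral_mkcond.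
have F0 := erestrict_ge0 f0; apply/eqP; rewrite eq_le ge0_integralZl_le//=.
(* The reverse inequality is the same one for the factor [k^-1] and the function [k * f]. *)
rewrite -lee_pdivlMl//.
apply: le_trans (ge0_integralZl_le (k := k^-1) _ _); last 2 first.
- by rewrite invr_gt0.
- by move=> x; rewrite mule_ge0// lee_fin ltW.
apply: ge0_le_integral_nonmeasurable => // x _.
by rewrite muleA -EFinM mulVf ?gt_eqF// mul1e.
Qed.

Lemma integralZl_nonmeasurable D f (k : R) : (0 < k)%R ->
  \int[mu]_(x in D) (k%:E * f x) = k%:E * \int[mu]_(x in D) f x.
Proof.
move=> k0; rewrite integralE [in RHS]integralE gt0_muleDr//.
rewrite muleN -!ge0_integralZl_nonmeasurable//.
by rewrite (ge0_funeposM _ (ltW k0)) (ge0_funenegM _ (ltW k0)).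
Qed.

End MonotoneIntegral.

(** * Change of variables under dilations *)

Section Dilation.
Local Open Scope ereal_scope.
Context {R : realType}.
Local Notation mu := (@lebesgue_measure R).

Let dil (l : R) : measurableTypeR R -> measurableTypeR R := fun t => (l * t)%R.

Let measurable_dil l : measurable_fun setT (dil l).
Proof. exact: mulrl_measurable. Qed.

(** Uniqueness of Lebesgue measure: [l] times the pushforward under the dilation has the right value
    on half-open intervals. *)
Lemma lebesgue_measure_dilation (l : R) (A : set R) : (0 < l)%R ->
  measurable A -> mu A = l%:E * mu ((fun t => (l * t)%R) @^-1` A).
Proof.
move=> l0 mA.
pose m : {measure set (measurableTypeR R) -> \bar R} :=
  mscale (NngNum (ltW l0)) (pushforward mu (dil l)).
rewrite (lebesgue_measure_unique (mu := m (measurable_dil l)))// => _ [[a b]] _ <-.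
rewrite /m /= /mscale /pushforward/=.
rewrite [X in _ = _ * lebesgue_measure X](_ : _ =
    `](a / l)%R, (b / l)%R]%classic); last first.
  apply/seteqP; split => t; rewrite /dil/= !in_itv/= => /andP[ta tb];
    by apply/andP; split; rewrite ?ltr_pdivrMr ?ler_pdivlMr// mulrC//;
    move: ta tb; rewrite ltr_pdivrMr ?ler_pdivlMr// mulrC.
rewrite !lebesgue_measure_itv/= !lte_fin ltr_pM2r ?invr_gt0//.
case: ifPn => _; last by rewrite mule0.
by rewrite -!EFinD -EFinM -mulrBl mulrC divfK ?gt_eqF.
Qed.

Lemma ge0_integral_dilation_measurable (l : R) (f : R -> \bar R) : (0 < l)%R ->
  measurable_fun setT f -> (forall t, 0 <= f t) ->
  \int[mu]_t f t = l%:E * \int[mu]_t f (l * t)%R.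
Proof.
move=> l0 mf f0.
have := ge0_integral_pushforward (measurable_dil l) mu measurableT mf
  (fun t _ => f0 t).
rewrite preimage_setT => <-.
rewrite -(@ge0_integral_mscale _ _ _ _ _ _ (NngNum (ltW l0)))//.
by apply: eq_measure_integral => A mA _; exact: lebesgue_measure_dilation.
Qed.

Import HBNNSimple.

(** As [f] may fail to be measurable, the change of variables, with ratio [l^-1], is made on each
    simple function below the dilated function. *)
Let ge0_integral_dilation_le (l : R) (f : R -> \bar R) : (0 < l)%R ->
  (forall t, 0 <= f t) -> \int[mu]_t f (l * t)%R <= l^-1%:E * \int[mu]_t f t.
Proof.
move=> l0 f0; rewrite ge0_integralTE//; apply: ge_ereal_sup => _ [h hf <-].
have li0 : (0 < l^-1)%R by rewrite invr_gt0.
have h0 t : 0 <= (h t)%:E by rewrite lee_fin.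
have mh : measurable_fun setT (EFin \o h) by exact/measurable_EFinP.
rewrite -integralT_nnsfun (ge0_integral_dilation_measurable li0 mh h0).
rewrite lee_pmul2l//; apply: ge0_le_integral_nonmeasurable => [t _|t _].
  by rewrite lee_fin.
by have := hf (l^-1 * t)%R; rewrite mulrA divff ?gt_eqF// mul1r.
Qed.

Lemma ge0_integral_dilation (l : R) (f : R -> \bar R) : (0 < l)%R ->
  (forall t, (0 < t)%R -> 0 <= f t) ->
  \int[mu]_(t in `]0%R, +oo[) f t = l%:E * \int[mu]_(t in `]0%R, +oo[) f (l * t)%R.
Proof.
move=> l0 f0; have li0 : (0 < l^-1)%R by rewrite invr_gt0.
rewrite integral_mkcond [in RHS]integral_mkcond.
set F := f \_ _; set G := _ \_ _.
have F0 t : 0 <= F t.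
  by apply: erestrict_ge0 => u /=; rewrite in_itv/= andbT; exact: f0.
(* The half-line is invariant under dilation, so extension by zero commutes with it. The inequality
   for [l] and for [l^-1] then gives equality. *)
have GE : G = fun t => F (l * t)%R.
  apply/funext => t; rewrite /G /F /patch /= !mem_setE !in_itv/= !andbT.
  by rewrite pmulr_rgt0.
have FE : F = fun t => G (l^-1 * t)%R.
  by apply/funext => t; rewrite GE mulrA divff ?gt_eqF// mul1r.
have G0 t : 0 <= G t by rewrite GE.
apply/eqP; rewrite eq_le; apply/andP; split.
  by rewrite {1}FE -[X in X%:E * _]invrK; exact: ge0_integral_dilation_le.
rewrite -lee_pdivlMl// {1}GE; exact: ge0_integral_dilation_le.
Qed.

Lemma integral_dilation (l : R) (f : R -> \bar R) : (0 < l)%R ->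
  \int[mu]_(t in `]0%R, +oo[) f t = l%:E * \int[mu]_(t in `]0%R, +oo[) f (l * t)%R.
Proof.
move=> l0; rewrite integralE [in RHS]integralE.
rewrite gt0_muleDr// (ge0_integral_dilation l0)// (@ge0_integral_dilation l f^\-)// muleN.
by congr (_ * _ + - (_ * _)); apply: eq_integral => t _; rewrite ?funeposE ?funenegE.
Qed.

End Dilation.

(** * Integrals of powers near 0 and at infinity *)

Section PowerIntegrals.
Context {R : realType}.
Local Notation mu := (@lebesgue_measure R).

Lemma continuous_powR_gt0 (q t : R) : 0 < t -> {for t, continuous (fun t : R => t `^ q)}.
Proof.
move=> t0; apply: differentiable_continuous; apply/derivable1_diffP.
by apply: ex_derive; exact: is_derive1_powR.
Qed.

Lemma integral_powR (a b q : R) : 0 < a -> a < b -> q != 0 ->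
  (\int[mu]_(t in `[a, b]) (t `^ (q - 1))%:E = ((b `^ q - a `^ q) / q)%:E)%E.
Proof.
move=> a0 ab q0; have b0 := lt_trans a0 ab.
pose F := fun t : R => q^-1 * t `^ q.
have dF (t : R) : 0 < t -> is_derive t 1 F (t `^ (q - 1)).
  move=> t0; have := is_deriveZ q^-1 (is_derive1_powR q t0).
  by rewrite /GRing.scale/= mulrA mulVf// mul1r.
have cF (t : R) : 0 < t -> {for t, continuous F}.
  move=> t0; apply: differentiable_continuous; apply/derivable1_diffP.
  by apply: ex_derive; exact: dF.
rewrite (@continuous_FTC2 _ _ F)//.
- by rewrite -EFinB /F -mulrBr mulrC.
- apply: continuous_in_subspaceT => t; rewrite inE/= in_itv/= => /andP[ta _].
  by apply: continuous_powR_gt0; exact: lt_le_trans ta.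
- split.
  + move=> t; rewrite in_itv/= => /andP[ta _]; apply: ex_derive.
    by apply: dF; exact: lt_trans ta.
  + by apply: cvg_at_right_filter; exact: cF.
  + by apply: cvg_at_left_filter; exact: cF.
- move=> t; rewrite in_itv/= => /andP[ta _]; rewrite derive1E.
  by apply: derive_val; apply: dF; exact: lt_trans ta.
Qed.

(** Serves to bound improper integrals, by exhausting the domain with intervals on which the
    fundamental theorem of calculus applies. *)
Lemma ge0_integral_bigcup_le (F : (set R)^nat) (f : R -> \bar R) (B : \bar R) :
  nondecreasing_seq F -> (forall n, measurable (F n)) ->
  (forall n, measurable_fun (F n) f) -> (forall n t, F n t -> 0 <= f t)%E ->
  (forall n, \int[mu]_(t in F n) f t <= B)%E ->
  (\int[mu]_(t in \bigcup_n F n) f t <= B)%E.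
Proof.
move=> ndF mF mf f0 FB.
have Fcvg := ge0_nondecreasing_set_cvg_integral (mu := mu) ndF mF mf f0.
 rewrite -(cvg_lim _ Fcvg)//; apply: lime_le; first exact/cvg_ex/ex_intro/Fcvg.
exact: nearW.
Qed.

Let measurable_powRE (D : set R) (q : R) :
  measurable_fun D (fun t : R => (t `^ q)%:E).
Proof. by apply/measurable_EFinP; apply: measurable_funTS; exact: measurable_powR. Qed.

Lemma integral_powR_near0 (q : R) : 0 < q ->
  (\int[mu]_(t in `]0%R, 1%R]) (t `^ (q - 1))%:E <= q^-1%:E)%E.
Proof.
(* [n.+2] keeps the left endpoint strictly below [1], as [integral_powR] requires. *)
move=> q0; pose F n : set R := `[(n.+2%:R^-1), 1]%classic.
have -> : `]0%R, 1%R]%classic = \bigcup_n F n.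
  apply/seteqP; split => [t|t [n _]]; rewrite /F/= !in_itv/=.
    move=> /andP[t0 t1]; exists (Num.truncn t^-1) => //=.
    rewrite in_itv/= t1 andbT invf_ple ?posrE//.
    by apply: ltW; apply: lt_trans (truncnS_gt _) _; rewrite ltr_nat.
  by move=> /andP[nt ->]; rewrite andbT; apply: lt_le_trans nt; rewrite invr_gt0.
apply: ge0_integral_bigcup_le.
- move=> m n mn; apply/subsetPset => t; rewrite /F/= !in_itv/= => /andP[mt ->].
  by rewrite andbT; apply: le_trans mt; rewrite lef_pV2 ?posrE// ler_nat.
- by move=> n; exact: measurable_itv.
- by move=> n; exact: measurable_powRE.
- by move=> n t _; rewrite lee_fin powR_ge0.
- move=> n; rewrite integral_powR ?gt_eqF// ?invr_gt0//; last first.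
    by rewrite invf_lt1// ltr1n.
  rewrite lee_fin powR1 ler_pdivrMr// mulVf ?gt_eqF// gerBl.
Qed.

Lemma integral_powR_infty (q : R) : 0 < q ->
  (\int[mu]_(t in `]1%R, +oo[) (t `^ (- q - 1))%:E <= q^-1%:E)%E.
Proof.
move=> q0; pose F n : set R := `]1, n.+2%:R]%classic.
have -> : `]1%R, +oo[%classic = \bigcup_n F n.
  apply/seteqP; split => [t|t [n _]]; rewrite /F/= !in_itv/= ?andbT.
    move=> t1; exists (Num.truncn t) => //=.
    rewrite in_itv/= t1/=; apply: ltW.
    by apply: lt_trans (truncnS_gt _) _; rewrite ltr_nat.
  by move=> /andP[].
apply: ge0_integral_bigcup_le.
- move=> m n mn; apply/subsetPset => t; rewrite /F/= !in_itv/= => /andP[-> /=] tm.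
  by apply: le_trans tm _; rewrite ler_nat.
- by move=> n; exact: measurable_itv.
- by move=> n; exact: measurable_powRE.
- by move=> n t _; rewrite lee_fin powR_ge0.
- move=> n; rewrite /F integral_itv_obnd_cbnd//.
  rewrite integral_powR ?oppr_eq0 ?gt_eqF// ?ltr1n//.
  rewrite lee_fin powR1 invrN mulrN -mulNr opprB ler_pdivrMr// mulVf ?gt_eqF// gerBl.
Qed.

(** Growth profile of the second differences in the barrier argument: quadratic inside the test
    ball, where a polynomial replaces [u], and linear outside. *)
Definition qlin (y : R) : R := Num.min (y ^+ 2) y.

Lemma qlin_ge0 (y : R) : 0 <= y -> 0 <= qlin y.
Proof. by move=> y0; rewrite le_min sqr_ge0. Qed.

Lemma measurable_qlin (a : R) (D : set R) : measurable_fun D (fun t => qlin (a * t)).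
Proof.
apply: measurable_minr; first apply: measurable_funX; exact: mulrl_measurable.
Qed.

Lemma measurable_kernel (q : R) (f : R -> R) (D : set R) :
  measurable_fun D f -> measurable_fun D (fun t : R => (f t / t `^ q)%:E).
Proof.
move=> mf; apply/measurable_EFinP; apply: measurable_funM => //.
under eq_fun do rewrite -powRN.
apply: measurable_funTS; exact: measurable_powR.
Qed.

(** Split at [1]. Near 0 the integrand is [t^(1 - 2s)], integrable as [s < 1]; at infinity it is
    [t^(-2s)], integrable as [s > 1/2]. [J] is the sum of the two bounds. *)
Lemma integral_qlin (s : R) : 2^-1 < s < 1 -> exists2 J : R, 0 < J &
  (\int[mu]_(t in `]0%R, +oo[) (qlin t / t `^ (1 + 2 * s))%:E <= J%:E)%E.
Proof.
move=> /andP[s1 s2].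
exists ((2 - 2 * s)^-1 + (2 * s - 1)^-1).
  by rewrite addr_gt0// invr_gt0; lra.
rewrite (_ : `]0%R, +oo[%classic = `]0, 1] `|` `]1, +oo[ :> set R); last first.
  apply/seteqP; split => t /=; rewrite !in_itv/= !andbT; last by case; lra.
  by move=> t0; have [t1|t1] := leP t 1; [left|right]; rewrite ?t0.
rewrite ge0_integral_setU//.
- rewrite EFinD; apply: leeD.
  + apply: le_trans (integral_powR_near0 _); last by lra.
    apply: ge0_le_integral_nonmeasurable => t /=; rewrite in_itv/= => /andP[t0 t1].
      by rewrite lee_fin divr_ge0 ?powR_ge0// qlin_ge0// ltW.
    rewrite lee_fin ler_pdivrMr ?powR_gt0// -powRD; last by rewrite implybE (gt_eqF t0) orbT.
    rewrite (_ : 2 - 2 * s - 1 + (1 + 2 * s) = 2%:R); last by ring.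
    by rewrite (powR_mulrn _ (ltW t0)) /qlin ge_min lexx.
  + apply: le_trans (integral_powR_infty _); last by lra.
    apply: ge0_le_integral_nonmeasurable => t /=; rewrite in_itv/= andbT => t1.
      by rewrite lee_fin divr_ge0 ?powR_ge0// qlin_ge0//; lra.
    have t0 : 0 < t by lra.
    rewrite lee_fin ler_pdivrMr ?powR_gt0// -powRD; last by rewrite implybE (gt_eqF t0) orbT.
    rewrite (_ : - (2 * s - 1) - 1 + (1 + 2 * s) = 1); last by ring.
    by rewrite (powRr1 (ltW t0)) /qlin ge_min lexx orbT.
- apply: measurable_kernel; have := @measurable_qlin 1.
  by under eq_fun do rewrite mul1r; apply.
- move=> t /= tD; have t0 : 0 < t by move: tD; rewrite !in_itv/= => -[]; lra.
  by rewrite lee_fin divr_ge0 ?powR_ge0// qlin_ge0// ltW.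
- apply/disj_setPS => t /=; rewrite !in_itv/= => -[]; lra.
Qed.

End PowerIntegrals.

(** * One-sided bounds for the operator *)

Section KernelBounds.
Context {R : realType}.
Local Notation mu := (@lebesgue_measure R).
Local Notation halfline := (`]0%R, +oo[%classic : set R).
Variables (s J : R).
Hypothesis hs : 2^-1 < s < 1.
Hypothesis hJ :
  (\int[mu]_(t in halfline) (qlin t / t `^ (1 + 2 * s))%:E <= J%:E)%E.

Let qlin_kernel_ge0 (r t : R) : 0 < r -> 0 < t ->
  (0 <= (qlin (r^-1 * t) / t `^ (1 + 2 * s))%:E)%E.
Proof.
move=> r0 t0; rewrite lee_fin divr_ge0 ?powR_ge0// qlin_ge0// mulr_ge0 ?ltW//.
by rewrite invr_gt0.
Qed.

Let measurable_qlin_kernel (r : R) (D : set R) :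
  measurable_fun D (fun t => (qlin (r^-1 * t) / t `^ (1 + 2 * s))%:E).
Proof. by apply: measurable_kernel; exact: measurable_qlin. Qed.

(** In the substitution [t = r * t'] the measure gives [r] and the kernel [r^-(1 + 2s)], hence the
    factor [r^(-2s)]. *)
Let integral_qlin_dil (r : R) : 0 < r ->
  (\int[mu]_(t in halfline) (qlin (r^-1 * t) / t `^ (1 + 2 * s))%:E
   <= (J * r `^ (- (2 * s)))%:E)%E.
Proof.
move=> r0; rewrite (integral_dilation _ r0).
have J0 : 0 <= J.
  rewrite -lee_fin; apply: le_trans hJ; apply: integral_ge0 => t /=.
  rewrite in_itv/= andbT => t0; have := qlin_kernel_ge0 ltr01 t0.
  by rewrite invr1 mul1r.
rewrite -lee_pdivlMl//.
rewrite (_ : _ * _ = (r `^ (- (1 + 2 * s)) * J)%:E)%E; last first.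
  rewrite -EFinM opprD powRD; last by rewrite implybE (gt_eqF r0) orbT.
  by rewrite powR_inv1 ?ltW// -mulrA [_ * J]mulrC.
apply: (@le_trans _ _ (\int[mu]_(t in halfline)
   ((r `^ (- (1 + 2 * s)))%:E * (qlin t / t `^ (1 + 2 * s))%:E)))%E.
  apply: ge0_le_integral_nonmeasurable => t /=; rewrite in_itv/= andbT => t0.
    by apply: qlin_kernel_ge0; rewrite // mulr_gt0.
  rewrite mulrA mulVf ?gt_eqF// mul1r -EFinM lee_fin.
  by rewrite (powRM _ (ltW r0) (ltW t0)) invfM powRN mulrCA lexx.
rewrite ge0_integralZl//.
- by rewrite EFinM lee_pmul2l// lte_fin powR_gt0.
- apply: measurable_kernel; have := @measurable_qlin R 1.
  by under eq_fun do rewrite mul1r; apply.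
- move=> t /=; rewrite in_itv/= andbT => t0; have := qlin_kernel_ge0 ltr01 t0.
  by rewrite invr1 mul1r.
- by rewrite lee_fin powR_ge0.
Qed.

Let integrable_qlin (r : R) : 0 < r ->
  mu.-integrable halfline (fun t => (qlin (r^-1 * t) / t `^ (1 + 2 * s))%:E).
Proof.
move=> r0; apply/integrableP; split; first exact: measurable_qlin_kernel.
apply: (@le_lt_trans _ _ (J * r `^ (- (2 * s)))%:E); last exact: ltry.
apply: le_trans (integral_qlin_dil r0).
apply: ge0_le_integral_nonmeasurable => // t /=; rewrite in_itv/= andbT => t0.
by have := qlin_kernel_ge0 r0 t0; rewrite !lee_fin => k0; rewrite ger0_norm.
Qed.

(** Marks the stretch of a ray known to lie outside the domain, as in [exits]. *)
Let window (h t : R) : R := \1_(`[h, 2 * h]%classic : set R) t.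

Let windowE (h t : R) : window h t = ((h <= t <= 2 * h)%R)%:R.
Proof. by rewrite /window indicE mem_setE in_itv. Qed.

Let measurable_window (h : R) (D : set R) : measurable_fun D (window h).
Proof. exact: measurable_indic. Qed.

Let integrable_window (h : R) : 0 < h ->
  mu.-integrable halfline (fun t => (window h t / t `^ (1 + 2 * s))%:E).
Proof.
(* On the window [t >= h], so [qlin (h^-1 * t) >= 1] dominates the indicator. *)
move=> h0; apply: le_integrable (integrable_qlin h0) => //.
  by apply: measurable_kernel; exact: measurable_window.
move=> t /=; rewrite in_itv/= andbT => t0.
rewrite lee_fin !ger0_norm ?divr_ge0 ?powR_ge0 ?windowE ?ler0n//; last first.
  by rewrite qlin_ge0// mulr_ge0 ?ltW// invr_gt0.
rewrite ler_pM2r ?invr_gt0 ?powR_gt0//; have [/andP[ht _]|_] /= := boolP (_ && _).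
  have : 1 <= h^-1 * t by rewrite ler_pdivlMl// mulr1.
  by move=> t1; rewrite /qlin le_min t1 andbT expr_ge1// (le_trans _ t1).
by rewrite qlin_ge0// mulr_ge0 ?ltW// invr_gt0.
Qed.

(** The window has length [h], the kernel is at least [(2h)^-(1 + 2s)] on it, and
    [2^-(1 + 2s) >= 1/8] because [s < 1]. *)
Let integral_window (h : R) : 0 < h ->
  ((h `^ (- (2 * s)) / 8)%:E <=
   \int[mu]_(t in halfline) (window h t / t `^ (1 + 2 * s))%:E)%E.
Proof.
move=> h0; have h20 : 0 < 2 * h by rewrite mulr_gt0.
apply: (@le_trans _ _ (\int[mu]_(t in halfline)
  (((2 * h) `^ (- (1 + 2 * s)))%:E * (window h t)%:E)))%E; last first.
  apply: ge0_le_integral_nonmeasurable => t /=; rewrite in_itv/= andbT => t0.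
    by rewrite -EFinM lee_fin mulr_ge0 ?powR_ge0// windowE ler0n.
  rewrite -EFinM lee_fin windowE; have [/andP[_ th]|_] /= := boolP (_ && _).
    rewrite mulr1 mul1r powRN lef_pV2 ?posrE ?powR_gt0//.
    apply: ge0_ler_powR; rewrite ?nnegrE ?(ltW t0) ?(ltW h20)//.
    by case/andP: hs; lra.
  by rewrite mulr0 mul0r.
rewrite ge0_integralZl; first last.
- by rewrite lee_fin powR_ge0.
- by move=> t _; rewrite lee_fin windowE ler0n.
- by apply/measurable_EFinP; exact: measurable_window.
- by [].
rewrite integral_indic// (_ : _ `&` _ = `[h, 2 * h]%classic); last first.
  apply/seteqP; split => t /=; first by case.
  by rewrite !in_itv/= => /andP[ht ->]; split; rewrite ?ht// andbT; lra.
rewrite [X in (_ * X)%E](lebesgue_measure_itv `[h, 2 * h])/= lte_fin ifT; last by lra.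
rewrite -EFinD -EFinM lee_fin (_ : 2 * h - h = h); last by lra.
rewrite (powRM _ (ler0n _ 2) (ltW h0)) opprD powRD; last by rewrite implybE pnatr_eq0 orbT.
rewrite [h `^ (_ + _)]powRD; last by rewrite implybE (gt_eqF h0) orbT.
rewrite (powR_inv1 (ltW h0)).
rewrite (_ : _ * h = h `^ (- (2 * s)) * (2 `^ (-1) * 2 `^ (- (2 * s)))); last first.
  by field; rewrite gt_eqF.
rewrite ler_wpM2l ?powR_ge0// -powRD; last by rewrite implybE pnatr_eq0 orbT.
rewrite (_ : 8^-1 = 2 `^ (- 3%:R)); last by rewrite powRN powR_mulrn//; congr _^-1; ring.
by apply: ler_powR; [rewrite ler1n|case/andP: hs; lra].
Qed.

(** The first bound serves subsolutions, the second supersolutions. The second is not just the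
    negation of the first: the sign leaves the integral of a possibly nonmeasurable [f] only through
    the integrable majorant. *)
Lemma kernel_integral_bounds (A B r h : R) (f : R -> R) :
  0 <= A -> 0 <= B -> 0 < r -> 0 < h ->
  (forall t, 0 < t -> f t <= A * qlin (r^-1 * t) - B * \1_(`[h, 2 * h]%classic : set R) t) ->
  ((\int[mu]_(t in halfline) (f t / t `^ (1 + 2 * s))%:E <=
    (A * (J * r `^ (- (2 * s))) - B * (h `^ (- (2 * s)) / 8))%:E) /\
   ((- (A * (J * r `^ (- (2 * s))) - B * (h `^ (- (2 * s)) / 8)))%:E <=
    \int[mu]_(t in halfline) (- f t / t `^ (1 + 2 * s))%:E))%E.
Proof.
move=> A0 B0 r0 h0 fle.
pose g1 t := A * (qlin (r^-1 * t) / t `^ (1 + 2 * s)).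
pose g2 t := B * (window h t / t `^ (1 + 2 * s)).
have ig1 : mu.-integrable halfline (EFin \o g1).
  exact: (integrableZl _ A (integrable_qlin r0)).
have ig2 : mu.-integrable halfline (EFin \o g2).
  exact: (integrableZl _ B (integrable_window h0)).
have ig : mu.-integrable halfline (fun t => (g1 t)%:E - (g2 t)%:E)%E.
  exact: integrableB.
have gle : (\int[mu]_(t in halfline) ((g1 t)%:E - (g2 t)%:E) <=
    (A * (J * r `^ (- (2 * s))) - B * (h `^ (- (2 * s)) / 8))%:E)%E.
  rewrite integralB_EFin// EFinB leeB//.
    rewrite /g1; under eq_integral do rewrite EFinM.
    rewrite integralZl//; last exact: integrable_qlin.
    by rewrite EFinM lee_wpmul2l ?lee_fin// integral_qlin_dil.
  rewrite /g2; under eq_integral do rewrite EFinM.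
  rewrite integralZl//; last exact: integrable_window.
  by rewrite EFinM lee_wpmul2l ?lee_fin// integral_window.
have fg t : halfline t ->
    ((f t / t `^ (1 + 2 * s))%:E <= (g1 t)%:E - (g2 t)%:E)%E.
  rewrite /= in_itv/= andbT => t0; rewrite -EFinB lee_fin /g1 /g2 !mulrA -mulrBl.
  by rewrite ler_pM2r ?fle// invr_gt0 powR_gt0.
split; first by apply: le_trans gle; exact: le_integral_nonmeasurable.
rewrite EFinN; apply: (@le_trans _ _
  (- \int[mu]_(t in halfline) ((g1 t)%:E - (g2 t)%:E))%E); first by rewrite leeN2.
under [leRHS]eq_integral do rewrite mulNr EFinN.
apply: le_integralN_nonmeasurable => //.
rewrite -ge0_fin_numE; first exact: integrable_pos_fin_num.
exact: integral_ge0.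
Qed.

End KernelBounds.

(** * Quadratic test functions *)

Section Biquadratic.
Context {R : realType} {N : nat}.
Implicit Types (x y z v : 'rV[R]_N) (f : 'rV[R]_N -> R).

Lemma is_derive_quadratic f x v (l c : R) :
  (forall h : R, f (h *: v + x) = f x + h * l + h ^+ 2 * c) -> is_derive x v f l.
Proof.
move=> fE.
have lim : (fun h => h^-1 *: ((f \o shift x) (h *: v) - f x)) @ 0^' --> l.
  have : (fun h : R => l + h * c) @ 0^' --> l.
    have : (fun h : R => l + h * c) @ (0 : R) --> l + 0 * c.
      by apply: cvgD; [exact: cvg_cst|apply: cvgMl; exact: cvg_id].
    by rewrite mul0r addr0 => h1; apply: cvg_within_filter h1.
  apply: cvg_trans; apply: near_eq_cvg; near=> h.
  have h0 : h != 0 by near: h; exact: nbhs_dnbhs_neq.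
  rewrite /= fE /GRing.scale/= [_ - f x]addrC !addrA addNr add0r expr2 -mulrA.
  by rewrite -mulrDr mulrA mulVf// mul1r.
by apply: DeriveDef; [exact/cvg_ex/ex_intro/lim|exact: cvg_lim lim].
Unshelve. all: by end_near. Qed.

Lemma continuous_dot_sub v z : continuous (fun x => dot v (x - z)).
Proof.
move=> x; apply/(@cvgrPdist_lt _ _ _ (nbhs x) (nbhs_filter x)) => e e0.
have v1 : 0 < enorm v + 1 by rewrite ltr_wpDl ?enorm_ge0.
have e1 : 0 < e / (enorm v + 1) by rewrite divr_gt0.
near=> y; have : enorm (y - x) < e / (enorm v + 1).
  by near: y; exact: nbhs_eballx.
rewrite ltr_pdivlMr// => xy.
rewrite -dotNr -dotDr opprB addrA subrK.
apply: le_lt_trans (dot_le_enorm _ _) _; rewrite enormBC.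
by have := enorm_ge0 (y - x); have := enorm_ge0 v; nra.
Unshelve. all: by end_near. Qed.

Lemma continuous_dot_subsub z : continuous (fun x => dot (x - z) (x - z)).
Proof.
rewrite (_ : (fun x => _) = fun x => enorm (x - z) * enorm (x - z)); last first.
  by apply/funext => x; rewrite -sqr_enorm expr2.
move=> x; have cx := @continuous_enorm_sub R N z x.
exact: (cvgM cx cx).
Qed.

(** Form of all test functions of the barrier argument: one paraboloid is the tangent to the
    barrier, centred at the exterior point, and the other localizes around an almost maximum
    point. *)
Definition biquad (a : R) z (b : R) y (k : R) x : R :=
  a * dot (x - z) (x - z) + b * dot (x - y) (x - y) + k.

Lemma continuous_biquad a z b y k : continuous (biquad a z b y k).
Proof.
move=> x; have cz := @continuous_dot_subsub z x; have cy := @continuous_dot_subsub y x.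
exact: (cvgD (cvgD (cvgMr cz) (cvgMr cy)) (cvg_cst k)).
Qed.

Lemma biquad_shift a z b y k x v :
  biquad a z b y k (x + v) = biquad a z b y k x +
    (2 * a * dot v (x - z) + 2 * b * dot v (x - y)) + (a + b) * dot v v.
Proof.
rewrite /biquad ![x + v - _]addrAC !(dotDl _ v) !(dotDr _ _ v).
rewrite ![dot (x - _) v]dotC; ring.
Qed.

Lemma biquad_second_difference a z b y k x v :
  biquad a z b y k (x + v) + biquad a z b y k (x - v) - 2 * biquad a z b y k x =
  2 * (a + b) * dot v v.
Proof. by rewrite !biquad_shift !(dotNl, dotNr); ring. Qed.

Lemma biquad_C2 (U : set 'rV[R]_N) a z b y k : C2_closure U (biquad a z b y k).
Proof.
pose e i : 'rV[R]_N := delta_mx ord0 i.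
pose d1 i x := 2 * a * dot (e i) (x - z) + 2 * b * dot (e i) (x - y).
pose d2 i j (x : 'rV[R]_N) := (2 * a + 2 * b) * dot (e j) (e i).
have D1 i x : is_derive x (e i) (biquad a z b y k) (d1 i x).
  apply: (@is_derive_quadratic _ _ _ _ ((a + b) * dot (e i) (e i))) => h.
  by rewrite addrC biquad_shift !(dotZl, dotZr) /d1; ring.
have D2 i j x : is_derive x (e i) (d1 j) (d2 i j x).
  apply: (@is_derive_quadratic _ _ _ _ 0) => h.
  by rewrite /d1 /d2 ![h *: e i + x - _]addrAC -!addrA !dotDr !dotZr; ring.
have E1 i : partial i (biquad a z b y k) = d1 i.
  by apply/funext => x; exact: (@derive_val _ _ _ _ _ _ _ (D1 i x)).
have E2 i j : partial i (partial j (biquad a z b y k)) = d2 i j.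
  by rewrite E1; apply/funext => x; exact: (@derive_val _ _ _ _ _ _ _ (D2 i j x)).
have c0 := @continuous_biquad a z b y k.
have c1 i : continuous (d1 i).
  move=> x; have cz := @continuous_dot_sub (e i) z x.
  have cy := @continuous_dot_sub (e i) y x.
  exact: (cvgD (cvgMr cz) (cvgMr cy)).
have c2 i j : continuous (d2 i j) by exact: cst_continuous.
split.
- split; first exact: continuous_subspaceT.
  move=> i; split; first by move=> x _; exact: (@ex_derive _ _ _ _ _ _ _ (D1 i x)).
  split; first by rewrite E1; exact: continuous_subspaceT.
  move=> j; split; last by split => //; rewrite E2; exact: continuous_subspaceT.
  by move=> x _; rewrite E1; exact: (@ex_derive _ _ _ _ _ _ _ (D2 j i x)).
- exact: continuous_subspaceT.
- by move=> i; exists (d1 i) => [|x _]; [exact: continuous_subspaceT|rewrite E1].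
- by move=> i j; exists (d2 i j) => [|x _]; [exact: continuous_subspaceT|rewrite E2].
Qed.

End Biquadratic.

(** * Viscosity inequalities at points touched by quadratic polynomials *)

Section Touching.
Context {R : realType} {N : nat}.
Implicit Types (x y z xi : 'rV[R]_N) (Omega : set 'rV[R]_N) (u : 'rV[R]_N -> R).

Definition second_difference u x xi (t : R) : R :=
  u (x + t *: xi) + u (x - t *: xi) - 2 * u x.

(* The part of the viscosity inequalities which the barrier argument uses; it
   holds for u if u is a subsolution and for - u if u is a supersolution. *)
Definition touching_bound (c s J K : R) Omega u : Prop :=
  forall x0 (rho a b k : R) y z (A B h : R) xi0,
  Omega x0 -> 0 < rho -> eclosed_ball x0 rho `<=` Omega ->
  biquad a z b y k x0 = u x0 ->
  (forall x, eball x0 rho x -> u x <= biquad a z b y k x) ->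
  0 <= A -> 0 <= B -> 0 < h ->
  (forall xi t, sphere xi -> 0 < t ->
     second_difference (Defs.glue x0 rho (biquad a z b y k) u) x0 xi t <=
     A * qlin (rho^-1 * t)) ->
  sphere xi0 ->
  (forall t, 0 < t ->
     second_difference (Defs.glue x0 rho (biquad a z b y k) u) x0 xi0 t <=
     A * qlin (rho^-1 * t) - B * \1_(`[h, 2 * h]%classic : set R) t) ->
  - K <= c * (2 * (A * (J * rho `^ (- (2 * s)))) - B * (h `^ (- (2 * s)) / 8)).

Section WithKernel.
Variables (c s J K : R).
Hypotheses (c0 : 0 < c) (hs : 2^-1 < s < 1).
Hypothesis hJ : (\int[lebesgue_measure]_(t in `]0%R, +oo[)
  (qlin t / t `^ (1 + 2 * s))%:E <= J%:E)%E.

Let Idir_bounds (A B r h : R) u x xi :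
  0 <= A -> 0 <= B -> 0 < r -> 0 < h ->
  (forall t, 0 < t -> second_difference u x xi t <=
     A * qlin (r^-1 * t) - B * \1_(`[h, 2 * h]%classic : set R) t) ->
  (Idir c s xi u x <=
    (c * (A * (J * r `^ (- (2 * s))) - B * (h `^ (- (2 * s)) / 8)))%:E /\
   (- (c * (A * (J * r `^ (- (2 * s))) - B * (h `^ (- (2 * s)) / 8))))%:E <=
    Idir c s xi (\- u)%R x)%E.
Proof.
move=> A0 B0 r0 h0 ule.
have [le1 le2] := kernel_integral_bounds hs hJ A0 B0 r0 h0 ule.
split; first by rewrite /Idir EFinM lee_pmul2l.
rewrite -mulrN EFinM /Idir lee_pmul2l//; apply: le_trans le2 _.
apply: le_integral_nonmeasurable => t _; rewrite lee_fin /second_difference.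
by rewrite !opprD !mulrN opprK.
Qed.

Let Idir_bounds0 (A r : R) u x xi : 0 <= A -> 0 < r ->
  (forall t, 0 < t -> second_difference u x xi t <= A * qlin (r^-1 * t)) ->
  (Idir c s xi u x <= (c * (A * (J * r `^ (- (2 * s)))))%:E /\
   (- (c * (A * (J * r `^ (- (2 * s))))))%:E <= Idir c s xi (\- u)%R x)%E.
Proof.
move=> A0 r0 ule; have := @Idir_bounds A 0 r 1 u x xi A0 (lexx _) r0 ltr01.
by rewrite !mul0r subr0; apply => t t0; rewrite mul0r subr0; exact: ule.
Qed.

(** The infimum is at most the operator in direction [xi0], which carries the gain from the window;
    the supremum is controlled by the bound common to all directions. Hence two terms in [A] and one
    in [B]. *)
Lemma subsolution_touching_bound Omega f u :
  (forall x, Omega x -> `|f x| <= K) ->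
  viscosity_subsolution c s Omega f u -> touching_bound c s J K Omega u.
Proof.
move=> fK [_ sub] x0 rho a b k y z A B h xi0 Ox0 rho0 ball_O touch above A0 B0 h0.
move=> all_le sxi0 xi0_le.
have fI := sub x0 rho _ Ox0 rho0 ball_O (@biquad_C2 _ _ _ a z b y k) touch above.
rewrite -lee_fin; apply: (@le_trans _ _ (f x0)%:E).
  by rewrite lee_fin; have := fK _ Ox0; rewrite ler_norml => /andP[].
apply: le_trans fI _.
rewrite (_ : forall T W : R, c * (2 * T - W) = c * (T - W) + c * T); last first.
  by move=> T W; ring.
rewrite EFinD; apply: leeD.
- apply: (@le_trans _ _ (Idir c s xi0 (Defs.glue x0 rho (biquad a z b y k) u) x0)).
    by apply: ereal_inf_lbound; exists xi0.
  by have [] := Idir_bounds A0 B0 rho0 h0 xi0_le.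
- apply: ge_ereal_sup => _ [xi sxi <-].
  by have [] := Idir_bounds0 A0 rho0 (fun t => all_le xi t sxi).
Qed.

(** Passing to [- u] exchanges infimum and supremum: the negated test function is again a [biquad],
    and [xi0] now bounds the supremum from below. *)
Lemma supersolution_touching_bound Omega f u :
  (forall x, Omega x -> `|f x| <= K) ->
  viscosity_supersolution c s Omega f u -> touching_bound c s J K Omega (\- u).
Proof.
move=> fK [_ sup] x0 rho a b k y z A B h xi0 Ox0 rho0 ball_O touch above A0 B0 h0.
move=> all_le sxi0 xi0_le.
have bqN x : biquad (- a) z (- b) y (- k) x = - biquad a z b y k x.
  by rewrite /biquad; ring.
have glueE : Defs.glue x0 rho (biquad (- a) z (- b) y (- k)) u =
             \- Defs.glue x0 rho (biquad a z b y k) (\- u).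
  by apply/funext => x /=; rewrite /Defs.glue; case: ifP => _; rewrite ?bqN ?opprK.
have fI : (Iop c s (Defs.glue x0 rho (biquad (- a) z (- b) y (- k)) u) x0 <= (f x0)%:E)%E.
  apply: sup => //; first exact: biquad_C2.
    by rewrite bqN touch opprK.
  by move=> x /above; rewrite bqN lerNl.
rewrite lerNl -lee_fin; apply: le_trans (le_trans fI _); last first.
  by rewrite lee_fin; have := fK _ Ox0; rewrite ler_norml => /andP[].
rewrite glueE (_ : forall T W : R, c * (2 * T - W) = c * T + c * (T - W)); last first.
  by move=> T W; ring.
rewrite opprD EFinD; apply: leeD.
- apply/ereal_infP => _ [xi sxi <-].
  by have [] := Idir_bounds0 A0 rho0 (fun t => all_le xi t sxi).
- apply: (@le_trans _ _ (Idir c s xi0 (\- Defs.glue x0 rho (biquad a z b y k) (\- u)) x0)).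
    by have [] := Idir_bounds A0 B0 rho0 h0 xi0_le.
  by apply: ereal_sup_ubound; exists xi0.
Qed.

End WithKernel.
End Touching.

(** * The boundary barrier *)

Section PowerConcavity.
Context {R : realType}.

(** Young's inequality for [p^b] and [1] with exponents [1/b] and [1/(1 - b)]. *)
Lemma powR_bernoulli (b p : R) : 0 < b -> b < 1 -> 0 <= p ->
  p `^ b <= 1 + b * (p - 1).
Proof.
move=> b0 b1 p0; have b10 : 0 < 1 - b by lra.
have := @conjugate_powR R (p `^ b) 1 b^-1 (1 - b)^-1 (powR_ge0 _ _) ler01.
rewrite !invr_gt0 !invrK => /(_ b0 b10) /(_ _)/wrap[]; first by lra.
by rewrite -powRrM mulfV ?gt_eqF// powRr1// powR1 mulr1 mul1r; lra.
Qed.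

Lemma powR_tangent (b p q : R) : 0 < b -> b < 1 -> 0 <= p -> 0 < q ->
  p `^ b <= q `^ b * (1 + b * (p / q - 1)).
Proof.
move=> b0 b1 p0 q0; have pq : 0 <= p / q by rewrite divr_ge0// ltW.
have -> : p `^ b = q `^ b * (p / q) `^ b.
  by rewrite -powRM ?(ltW q0)// mulrC divfK ?gt_eqF.
by rewrite ler_wpM2l ?powR_ge0// powR_bernoulli.
Qed.

(** Tangent line at [q^2] to the concave power with exponent [b/2]. With [p] and [q] distances to a
    fixed point, the right side is a quadratic polynomial touching the barrier from above. *)
Lemma powR_sqr_tangent (b p q : R) : 0 < b -> b < 1 -> 0 <= p -> 0 < q ->
  p `^ b <= q `^ b + b / 2 * q `^ b / q ^+ 2 * (p ^+ 2 - q ^+ 2).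
Proof.
move=> b0 b1 p0 q0; have q20 : 0 < q ^+ 2 by rewrite exprn_gt0.
have E (r : R) : 0 <= r -> r `^ b = (r ^+ 2) `^ (b / 2).
  move=> r0; rewrite -powR_mulrn// -powRrM; congr (_ `^ _).
  by rewrite mulrC divfK.
have := @powR_tangent (b / 2) (p ^+ 2) (q ^+ 2) _ _ (sqr_ge0 _) q20.
rewrite -!E ?(ltW q0)// => /(_ _ _)/wrap[|//|]; [lra|lra|].
move=> h; apply: le_trans h _; rewrite le_eqVlt; apply/orP; left; apply/eqP.
by field; rewrite gt_eqF.
Qed.

End PowerConcavity.

Section Barrier.
Context {R : realType} {N : nat}.
Implicit Types (x y z xi : 'rV[R]_N) (Omega : set 'rV[R]_N) (u : 'rV[R]_N -> R).

(* The ratios 1/4 and 2 are fixed so that the barrier exponent does not depend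
   on Omega. *)
Definition exits Omega x : Prop := exists xi (h : R),
  [/\ sphere xi, 0 < h, eclosed_ball x (h / 4) `<=` Omega &
      forall t, h <= t <= 2 * h -> ~ Omega (x + t *: xi)].

(* 10368 = 8 * 36 ^ 2: in the barrier argument the exit distance is at most 36
   times the radius of the test ball. *)
Let theta : R := 10368%:R^-1.

(** Controls the barrier along steps that leave the test ball, by the triangle inequality and the
    tangent line to the power. *)
Lemma enorm_powR_le (b t : R) x z xi : 0 < b -> b < 1 -> 0 <= t -> enorm xi = t ->
  0 < enorm (x - z) ->
  enorm (x + xi - z) `^ b <=
    enorm (x - z) `^ b + b * enorm (x - z) `^ b * (t / enorm (x - z)).
Proof.
move=> b0 b1 t0 xit; set r := enorm (x - z) => r0.
have le_rt : enorm (x + xi - z) <= r + t.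
  by rewrite addrAC; apply: le_trans (enormD _ _) _; rewrite xit.
apply: (@le_trans _ _ ((r + t) `^ b)).
  by apply: ge0_ler_powR; rewrite ?nnegrE ?enorm_ge0 ?(ltW b0)// addr_ge0// ltW.
apply: le_trans (powR_tangent b0 b1 _ r0) _; first by rewrite addr_ge0// ltW.
by rewrite le_eqVlt; apply/orP; left; apply/eqP; field; rewrite gt_eqF.
Qed.

Lemma barrier (c s J K M b delta : R) Omega u :
  0 < c -> 2^-1 < s < 1 -> 0 < J -> 0 <= K ->
  0 < b -> b <= 2^-1 -> 8 * J * b <= theta ->
  touching_bound c s J K Omega u ->
  {within Omega, continuous u} -> (forall x, `|u x| <= M) ->
  (forall x, ~ Omega x -> u x = 0) ->
  0 < delta -> delta <= 1 ->
  (forall x z, Omega x -> ~ Omega z -> enorm (x - z) < delta -> exits Omega x) ->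
  exists2 C : R, 0 < C &
    forall x z, ~ Omega z -> u x <= C * enorm (x - z) `^ b.
Proof.
move=> c0 /andP[s1 s2] J0 K0 b0 b2 Jb tb cu uM u0 d0 d1 ex.
have b1 : b < 1 by lra.
have th0 : 0 < theta by rewrite invr_gt0 ltr0n.
have M0 : 0 <= M by apply: le_trans (uM 0); exact: normr_ge0.
have db0 : 0 < delta `^ b by rewrite powR_gt0.
(* [C1] lifts the barrier above [M] at distance [delta] from [z], so that [u > w] only happens
   nearer; [C2] beats the right-hand side at the end, and the [+ 1] in [C] makes that strict. *)
pose C1 := (M + 1) / delta `^ b; pose C2 := 2 * K / (c * theta).
have C10 : 0 <= C1 by rewrite divr_ge0 ?(ltW db0)//; lra.
have C20 : 0 <= C2 by rewrite divr_ge0 ?mulr_ge0// ltW.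
pose C := C1 + C2 + 1; have C0 : 0 < C by rewrite /C; lra.
exists C => // xbar z zO; rewrite leNgt; apply/negP => contra.
pose w x := C * enorm (x - z) `^ b.
have w0 x : 0 <= w x by rewrite mulr_ge0 ?powR_ge0// ltW.
have near_z x : w x < u x -> Omega x /\ enorm (x - z) < delta.
  move=> wu; split.
    by apply: contrapT => /u0 ux; have := w0 x; move: wu; rewrite ux; lra.
  rewrite ltNge; apply/negP => dx.
  have : M + 1 <= w x.
    apply: (@le_trans _ _ (C * delta `^ b)).
      by rewrite -ler_pdivrMr// /C -/C1; lra.
    rewrite ler_wpM2l ?(ltW C0)//; apply: ge0_ler_powR => //.
    - exact: ltW.
    - by rewrite nnegrE ltW.
    - by rewrite nnegrE enorm_ge0.
  by have := uM x; rewrite ler_norml => /andP[_]; lra.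
pose E := [set u x - w x | x in [set: 'rV[R]_N]].
have Eub : has_ubound E.
  exists M => _ [x _ <-]; have := uM x; rewrite ler_norml => /andP[_].
  by have := w0 x; lra.
have hE : has_sup E by split=> //; exists (u xbar - w xbar); exists xbar.
pose S := sup E.
have leS x : u x - w x <= S by apply: ub_le_sup => //; exists x.
have S0 : 0 < S by apply: lt_le_trans (leS xbar); rewrite subr_gt0.
(* The supremum need not be attained, as [u] may jump across the boundary. With a tolerance
   proportional to [b * S], the errors become small under the same condition on [b] as the barrier
   terms. *)
pose e := b / 2; have e0 : 0 < e by rewrite /e; lra.
have eS0 : 0 < e * S by rewrite mulr_gt0.
have eS1 : e * S < S by rewrite -[ltRHS]mul1r ltr_pM2r// /e; lra.
have [_ [x1 _ <-] x1S] := sup_adherent eS0 hE; rewrite -/S in x1S.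
have [Ox1 d1z] : Omega x1 /\ enorm (x1 - z) < delta by apply: near_z; lra.
have [xi1 [h1 [sxi1 h10 ball1 out1]]] := ex _ _ Ox1 zO d1z.
(* The ball of radius [2 * r] around [x1] lies in [Omega]. At distance [r] the paraboloid costs
   [2 * (e * S)], more than the deficit [e * S] of [x1], so [x2] falls within [r] of [x1] and keeps
   a ball of radius [r] inside [Omega]. *)
pose r := h1 / 8; have h1E : h1 / 4 = 2 * r by rewrite /r; lra.
have r0 : 0 < r by rewrite /r; lra.
have r20 : 0 < r ^+ 2 by rewrite exprn_gt0.
pose k := 2 * (e * S) / r ^+ 2; have k0 : 0 < k by rewrite divr_gt0 ?mulr_gt0.
have kr : k * r ^+ 2 = 2 * (e * S) by rewrite /k divfK ?gt_eqF.
pose Phi x := u x - w x - k * enorm (x - x1) ^+ 2.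
have [x2 x2B x2max] : exists2 x2, eclosed_ball x1 (h1 / 4) x2 &
    forall x, eclosed_ball x1 (h1 / 4) x -> Phi x <= Phi x2.
  have [|||x2 x2B x2max] := @compact_EVT_max _ R Phi (eclosed_ball x1 (h1 / 4)).
  - by exists x1; rewrite /eclosed_ball/= subrr enorm0; lra.
  - exact: eclosed_ball_compact.
  - have cu1 : {within eclosed_ball x1 (h1 / 4), continuous u}.
      exact: continuous_subspaceW ball1 cu.
    have cw : {within eclosed_ball x1 (h1 / 4), continuous w}.
      apply: continuous_in_subspaceT => x /set_mem /ball1 Ox.
      have xz : 0 < enorm (x - z).
        by rewrite enorm_gt0 subr_eq0; apply/eqP => xz; apply: zO; rewrite -xz.
      have cx := @continuous_enorm_sub R N z x.
      have cxb : (fun x => enorm (x - z) `^ b) @ x --> enorm (x - z) `^ b.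
        exact: (continuous_comp cx (@continuous_powR_gt0 R b _ xz)).
      exact: (cvgMr cxb).
    have ck : {within eclosed_ball x1 (h1 / 4),
        continuous (fun x => k * enorm (x - x1) ^+ 2)}.
      apply: continuous_subspaceT => x; have cx := @continuous_enorm_sub R N x1 x.
      exact: (cvgMr (cvgM cx cx)).
    by move=> x; exact: (cvgB (cvgB (cu1 x) (cw x)) (ck x)).
  - by exists x2 => [|x xB]; [exact: set_mem|apply: x2max; rewrite inE].
have x1B : eclosed_ball x1 (h1 / 4) x1.
  by rewrite /eclosed_ball/= subrr enorm0; lra.
have Phi1 : Phi x1 = u x1 - w x1.
  by rewrite /Phi subrr enorm0 expr0n/= mulr0 subr0.
have Phi2 := x2max _ x1B; rewrite Phi1 in Phi2.
have k2 : 0 <= k * enorm (x2 - x1) ^+ 2 by rewrite mulr_ge0 ?sqr_ge0// ltW.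
have x2S : S - e * S < u x2 - w x2 - k * enorm (x2 - x1) ^+ 2.
  exact: lt_le_trans x1S Phi2.
have x21 : enorm (x2 - x1) < r.
  rewrite ltNge; apply/negP => rx.
  have krx : k * r ^+ 2 <= k * enorm (x2 - x1) ^+ 2.
    by rewrite ler_pM2l// ler_sqr ?nnegrE ?enorm_ge0// ltW.
  have le2 := leS x2; clear -krx le2 x2S kr eS0; lra.
have x2S' : S - e * S < u x2 - w x2 by clear -k2 x2S; lra.
have [Ox2 d2z] : Omega x2 /\ enorm (x2 - z) < delta.
  by apply: near_z; clear -x2S' eS1; lra.
have [xi2 [h2 [sxi2 h20 ball2 out2]]] := ex _ _ Ox2 zO d2z.
have ball_r : eclosed_ball x2 r `<=` Omega.
  move=> x x2r; apply: ball1; rewrite /eclosed_ball/= in x2r *.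
  by apply: le_trans (enorm_triangle x2 _ _) _; clear -x2r x21 h1E; lra.
pose Rz := enorm (x2 - z).
have rR : r < Rz.
  rewrite ltNge; apply/negP => Rr; apply: zO; apply: ball_r.
  by rewrite /eclosed_ball/= enormBC.
have R0 : 0 < Rz := lt_trans r0 rR.
have rh2 : r < h2.
  rewrite ltNge; apply/negP => hr; apply: (out2 h2); first by clear -h20; lra.
  apply: ball_r; rewrite /eclosed_ball/= addrAC subrr add0r enormZ (gtr0_norm h20).
  by move: sxi2 => /= ->; rewrite mulr1.
(* Otherwise the ball of radius [h2 / 4 >= 9 * r] around [x2], contained in [Omega], would contain
   the outside point [x1 + h1 *: xi1], whose distance to [x2] is less than [h1 + r = 9 * r]. *)
have h2r : h2 < 36 * r.
  rewrite ltNge; apply/negP => rh; apply: (out1 h1); first by clear -h10; lra.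
  apply: ball2; rewrite /eclosed_ball/=.
  apply: le_trans (enorm_triangle x1 _ _) _.
  rewrite [x1 + _ - x1]addrAC subrr add0r enormZ (gtr0_norm h10) (enormBC x1).
  by move: sxi1 => /= ->; clear -x21 rh h1E; lra.
(* Slope given by [powR_sqr_tangent] at distance [Rz], times [C]. *)
pose a := C * (b / 2 * Rz `^ b / Rz ^+ 2).
have Rb0 : 0 < Rz `^ b by rewrite powR_gt0.
have a0 : 0 < a by rewrite mulr_gt0// divr_gt0 ?mulr_gt0 ?exprn_gt0 ?divr_gt0.
pose kk := u x2 - a * dot (x2 - z) (x2 - z) - k * dot (x2 - x1) (x2 - x1).
have touch : biquad a z k x1 kk x2 = u x2 by rewrite /biquad /kk; ring.
have above x : eball x2 r x -> u x <= biquad a z k x1 kk x.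
  move=> x2r; have : Phi x <= Phi x2.
    apply: x2max; rewrite /eclosed_ball/=.
    apply: le_trans (enorm_triangle x2 _ _) _.
    by rewrite /eball/= in x2r; clear -x2r x21 h1E; lra.
  have := powR_sqr_tangent b0 b1 (enorm_ge0 (x - z)) R0.
  rewrite -(ler_pM2l C0) mulrDr [C * (_ * _)]mulrA -/a.
  rewrite -[C * enorm (x - z) `^ b]/(w x) -[C * Rz `^ b]/(w x2).
  rewrite /Rz !sqr_enorm => tan; rewrite /Phi !sqr_enorm /biquad /kk => max2.
  by clear -tan max2; clearbody w a k; lra.
pose P := C * (b * Rz `^ b).
have P0 : 0 < P by rewrite mulr_gt0// mulr_gt0.
(* [2 * P] covers the growth of the barrier. [4 * (e * S)] is the contribution [2 * k * r^2] of the
   paraboloid inside the ball; outside, the almost maximality of [x2] costs at most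
   [2 * (e * S)]. *)
pose A := 2 * P + 4 * (e * S).
have A0 : 0 < A by rewrite /A; clear -P0 eS0; lra.
set psi := Defs.glue x2 r (biquad a z k x1 kk) u.
have psi2 : psi x2 = u x2.
  by rewrite /psi /Defs.glue subrr enorm0 (ltW r0) touch.
have enorm_step (t : R) xi : sphere xi -> 0 < t -> enorm (t *: xi) = t.
  by move=> /= xi1' t0; rewrite enormZ xi1' mulr1 gtr0_norm.
have glue_near (t : R) v : enorm v = t -> t <= r ->
    psi (x2 + v) = biquad a z k x1 kk (x2 + v).
  by move=> vt tr; rewrite /psi /Defs.glue addrAC subrr add0r vt tr.
have glue_far (t : R) v : enorm v = t -> r < t -> psi (x2 + v) = u (x2 + v).
  by move=> vt tr; rewrite /psi /Defs.glue addrAC subrr add0r vt leNgt tr.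
have far_le (t : R) v : enorm v = t -> r < t ->
    u (x2 + v) <= w x2 + P * (t / r) + S.
  move=> vt rt; have t0 : 0 < t := lt_trans r0 rt.
  have := enorm_powR_le b0 b1 (ltW t0) vt R0.
  rewrite -(ler_pM2l C0) mulrDr [C * (_ * _)]mulrA -/Rz -/P.
  rewrite -[C * enorm (x2 + v - z) `^ b]/(w (x2 + v)) -[C * Rz `^ b]/(w x2) => wle.
  have Ple : P * (t / Rz) <= P * (t / r).
    by rewrite ler_pM2l// ler_pM2l// lef_pV2 ?posrE// ltW.
  by have leSv := leS (x2 + v); clear -wle Ple leSv; clearbody w P; lra.
have qfar (t : R) : r < t -> qlin (r^-1 * t) = t / r.
  move=> rt; have t1 : 1 <= t / r by rewrite ler_pdivlMr// mul1r ltW.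
  rewrite mulrC /qlin; apply/min_idPr; rewrite expr2.
  by rewrite -[leLHS]mul1r ler_wpM2r// (le_trans ler01).
have eS_far (t : R) : r < t -> 4 * (e * S) <= 4 * (e * S) * (t / r).
  move=> rt; rewrite ler_peMr ?ler_pdivlMr// ?mul1r ?(ltW rt)//.
  by clear -eS0; lra.
have all_le xi (t : R) : sphere xi -> 0 < t ->
    second_difference psi x2 xi t <= A * qlin (r^-1 * t).
  move=> sxi t0; have txi := enorm_step _ _ sxi t0.
  have txiN : enorm (- (t *: xi)) = t by rewrite enormN.
  rewrite /second_difference psi2; have [tr|rt] := leP t r.
    rewrite !(glue_near t)// -touch biquad_second_difference -sqr_enorm txi.
    have -> : qlin (r^-1 * t) = (t / r) ^+ 2.
      rewrite mulrC /qlin; apply/min_idPl; rewrite expr2.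
      rewrite -[leRHS]mul1r; apply: ler_wpM2r; last by rewrite ler_pdivrMr// mul1r.
      by rewrite divr_ge0 ?(ltW r0) ?(ltW t0).
    rewrite (_ : _ * t ^+ 2 = (2 * a * r ^+ 2 + 2 * (k * r ^+ 2)) * (t / r) ^+ 2);
      last by field; rewrite gt_eqF.
    rewrite kr; apply: ler_wpM2r; first exact: sqr_ge0.
    have aP : 2 * a * r ^+ 2 <= 2 * P.
      rewrite -mulrA ler_pM2l// (_ : a * r ^+ 2 = P * (r ^+ 2 / Rz ^+ 2 / 2)); last first.
        by rewrite /a /P; field; rewrite gt_eqF.
      rewrite -[leRHS]mulr1 ler_pM2l//.
      have : r ^+ 2 / Rz ^+ 2 <= 1.
        rewrite ler_pdivrMr ?exprn_gt0// mul1r ler_sqr ?nnegrE ?(ltW r0) ?(ltW R0)//.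
        exact: ltW.
      by clear; lra.
    by rewrite /A; clear -aP; lra.
  rewrite !(glue_far t)// qfar//.
  have le1 := far_le _ _ txi rt; have le2 := far_le _ _ txiN rt.
  have eSle := eS_far _ rt.
  by rewrite /A; clear -le1 le2 eSle x2S' eS0; lra.
have xi2_le (t : R) : 0 < t -> second_difference psi x2 xi2 t <=
    A * qlin (r^-1 * t) - u x2 * \1_(`[h2, 2 * h2]%classic : set R) t.
  move=> t0; rewrite indicE mem_setE in_itv/=.
  have [ht|_] /= := boolP (_ && _); last by rewrite mulr0 subr0; exact: all_le.
  have txi := enorm_step _ _ sxi2 t0.
  have txiN : enorm (- (t *: xi2)) = t by rewrite enormN.
  have rt : r < t by clear -rh2 ht; lra.
  (* Since [u] vanishes at [x2 + t *: xi2], a single neighbouring value faces [2 * u x2], which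
     leaves a gain of one [u x2]. *)
  rewrite /second_difference psi2 !(glue_far t)// qfar// (u0 _ (out2 _ ht)) mulr1.
  have le2 := far_le _ _ txiN rt; have eSle := eS_far _ rt.
  have Ptr : 0 < P * (t / r) by rewrite mulr_gt0// divr_gt0.
  by rewrite /A; clear -le2 eSle Ptr x2S' eS0; lra.
have wx2 : w x2 = C * Rz `^ b by [].
have u2 : 0 <= u x2 by have w2 := w0 x2; clear -w2 x2S' eS1; lra.
have := tb x2 r a k kk x1 z A (u x2) h2 xi2 Ox2 r0 ball_r touch above
  (ltW A0) u2 h20 all_le sxi2 xi2_le.
apply/negP; rewrite -ltNge.
pose r2s := r `^ (- (2 * s)); have r2s0 : 0 < r2s by rewrite powR_gt0.
have s20 : 0 <= 2 * s by clear -s1; lra.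
(* Since [s < 1], [36^(-2s) >= 36^-2 = 1/1296]; together with the factor [1/8] of the window this is
   [theta]. *)
have h2s : r2s / 1296 <= h2 `^ (- (2 * s)).
  apply: (@le_trans _ _ ((36 * r) `^ (- (2 * s)))).
    rewrite (powRM _ (ler0n _ 36) (ltW r0)) mulrC ler_pM2r//.
    rewrite (_ : 1296^-1 = 36 `^ (- 2%:R)); last first.
      by rewrite powRN powR_mulrn//; congr _^-1; ring.
    by apply: ler_powR; [rewrite ler1n|clear -s2; lra].
  rewrite !powRN lef_pV2 ?posrE ?powR_gt0// ?mulr_gt0//.
  apply: ge0_ler_powR => //; rewrite ?nnegrE ?(ltW h20) ?(ltW h2r)//.
  by rewrite mulr_ge0// ltW.
(* [Rz^b >= Rz >= r >= r^(2s)], from [r < Rz <= 1] and [b <= 1 <= 2s]; the bound [delta <= 1] enters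
   here. *)
have Rr1 : 1 <= Rz `^ b * r2s.
  have R1 : Rz <= 1 by apply: le_trans (ltW d2z) d1.
  rewrite /r2s powRN ler_pdivlMr ?powR_gt0// mul1r.
  apply: (@le_trans _ _ Rz); last by apply: ger1_powR; rewrite ?R0 ?R1// ltW.
  apply: le_trans (ltW rR); apply: ge1r_powR; last by clear -s1; lra.
  by rewrite r0 (le_trans (ltW rR)).
(* The condition on [b] lets the gain [theta * u x2] absorb all positive terms and still leave half
   of [theta * C * Rz^b] to beat [K]. *)
have AJ : 2 * (A * J) <= theta * (u x2 - C * Rz `^ b / 2).
  have JP : 8 * J * b * (C * Rz `^ b) <= theta * (C * Rz `^ b).
    by rewrite ler_pM2r// mulr_gt0.
  have JS : 8 * J * b * S <= theta * S by rewrite ler_pM2r.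
  have uS : theta * (S - e * S + C * Rz `^ b) <= theta * u x2.
    by rewrite ler_pM2l//; clear -x2S' wx2; lra.
  have eS : theta * (e * S) <= theta * (S / 2).
    by rewrite ler_pM2l// mulrC ler_pM2l// /e; clear -b2; lra.
  rewrite (_ : 2 * (A * J) = (8 * J * b * (C * Rz `^ b)) / 2 + (8 * J * b * S) / 2).
    by clear -JP JS uS eS; lra.
  by rewrite /A /P /e; field.
have lhs : 2 * (A * (J * r2s)) - u x2 * (h2 `^ (- (2 * s)) / 8) <=
    - (theta * (C * Rz `^ b / 2)) * r2s.
  have u2h : u x2 * (r2s * theta) <= u x2 * (h2 `^ (- (2 * s)) / 8).
    apply: ler_wpM2l => //; rewrite (_ : r2s * theta = r2s / 1296 / 8).
      by rewrite ler_pM2r ?invr_gt0.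
    by rewrite /theta; field.
  have AJr : 2 * (A * J) * r2s <= theta * (u x2 - C * Rz `^ b / 2) * r2s.
    by rewrite ler_pM2r.
  by clear -u2h AJr; lra.
apply: (@le_lt_trans _ _ (c * (- (theta * (C * Rz `^ b / 2)) * r2s))).
  by rewrite ler_pM2l.
rewrite mulNr mulrN ltrN2.
apply: (@lt_le_trans _ _ (c * (theta * C / 2))).
  rewrite (_ : c * (theta * C / 2) = C * (c * theta) / 2); last by field.
  have ct : 0 < c * theta by rewrite mulr_gt0.
  have : 2 * K < C * (c * theta).
    by rewrite -ltr_pdivrMr// -/C2 /C; clear -C10; lra.
  by clear; lra.
rewrite ler_pM2l// (_ : theta * _ * r2s = theta * C / 2 * (Rz `^ b * r2s)); last by field.
by rewrite ler_peMr// divr_ge0// mulr_ge0// ltW.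
Qed.

End Barrier.

(** * Strict differentiability *)

Section DirectionalDerivatives.
Context {R : realType} {V : normedModType R}.
Implicit Types (f : V -> R) (x v : V).

Lemma is_derive_cvg (W : normedModType R) (f : W -> R) (x v : W) (l : R) :
  is_derive x v f l <->
  h^-1 *: (f (h *: v + x) - f x) @[h --> 0^'] --> l.
Proof.
split=> [[fx <-]|fx]; first exact: fx.
by apply: DeriveDef; [exact/cvg_ex/ex_intro/fx|exact: cvg_lim fx].
Qed.

Lemma is_derive_line f x v (t l : R) :
  is_derive (t *: v + x) v f l <-> is_derive t 1 (fun q : R => f (q *: v + x)) l.
Proof.
rewrite 2!is_derive_cvg.
have -> : (fun h : R => h^-1 *: (f (h *: v + (t *: v + x)) - f (t *: v + x))) =
    (fun h : R => h^-1 *: (f ((h *: (1 : R) + t) *: v + x) - f (t *: v + x))).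
  by apply/funext => h; rewrite [h *: 1]mulr1 scalerDl addrA.
exact: iff_refl.
Qed.

Lemma is_derive_dirZ f x v (a l : R) :
  is_derive x v f l -> is_derive x (a *: v) f (a * l).
Proof.
rewrite -[X in is_derive X v f _]add0r -[in X in X -> _](scale0r v) => /is_derive_line d.
rewrite -[X in is_derive X _ _ _]add0r -(scale0r (a *: v)); apply/is_derive_line.
have da : is_derive (0 : R) 1 (fun q : R => q * a) a.
  have := is_deriveZ a (is_derive_id (0 : R) (1 : R)).
  rewrite [a *: 1]mulr1.
  by rewrite (_ : a \*: id = fun q : R => q * a)//; apply/funext => q; rewrite /= mulrC.
rewrite -(mul0r a) in d; have := @is_derive1_comp _ _ (fun q : R => q * a) _ _ _ d da.
rewrite mulrC.
by congr is_derive; apply/funext => q /=; rewrite scalerA.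
Qed.

Lemma mean_value_dir f (df : V -> R) x v (L e : R) :
  (forall y, is_derive y v f (df y)) ->
  (forall t, 0 <= t <= 1 -> `|df (t *: v + x) - L| <= e) ->
  `|f (v + x) - f x - L| <= e.
Proof.
move=> fdf dfL.
have D (t : R) : is_derive t 1 (fun q : R => f (q *: v + x)) (df (t *: v + x)).
  exact/is_derive_line.
have cD : {within `[0%R, 1%R], continuous (fun q : R => f (q *: v + x))}.
  by apply: derivable_within_continuous => t _; exact: (@ex_derive _ _ _ _ _ _ _ (D t)).
have [c c01] := @MVT R _ (fun t => df (t *: v + x)) 0 1 ltr01 (fun t _ => D t) cD.
rewrite scale1r scale0r add0r subr0 mulr1 => ->; apply: dfL.
by move: c01; rewrite in_itv/= => /andP[? ?]; rewrite !ltW.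
Qed.

End DirectionalDerivatives.

Section StrictDifferentiability.
Context {R : realType} {n : nat}.
Implicit Types (f : 'rV[R]_n -> R) (q x y : 'rV[R]_n).

(* Move from x to y one coordinate at a time. *)
Lemma strictly_differentiable f q (e : R) :
  (forall i x, derivable f x (delta_mx ord0 i)) ->
  (forall i, continuous (partial i f)) -> 0 < e ->
  \forall d \near 0^'+, forall x y, ball q d x -> ball q d y ->
    `|f y - f x - \sum_(i < n) partial i f q * (y ord0 i - x ord0 i)| <=
    e * \sum_(i < n) `|y ord0 i - x ord0 i|.
Proof.
move=> df cf e0.
have : \forall z \near q, forall i, `|partial i f z - partial i f q| <= e.
  apply: (@filter_forall _ _ (fun i z => `|partial i f z - partial i f q| <= e)
    _ (nbhs_filter q)) => i; have := cf i q.
  move=> /(@cvgrPdist_le _ _ _ (nbhs q) (nbhs_filter q)) /(_ e e0).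
  by apply: filterS => z; rewrite distrC.
move=> /nbhs_ballP[d0 /= d00 near_q].
near=> d; have d_le : d <= d0 by near: d; exact: nbhs_right_le.
move=> x y qx qy.
pose p (k : nat) : 'rV[R]_n := \row_i (if (i < k)%N then y ord0 i else x ord0 i).
have p0 : p 0%N = x by apply/rowP => i; rewrite mxE.
have pn : p n = y by apply/rowP => i; rewrite mxE ltn_ord.
rewrite -{1}pn -{1}p0 -(telescope_sumr (fun k => f (p k)) (leq0n n)).
rewrite big_mkord -sumrB mulr_sumr.
apply: le_trans (ler_norm_sum _ _ _) _; apply: ler_sum => i _.
pose dl := y ord0 i - x ord0 i.
have pS : p i.+1 = dl *: delta_mx ord0 i + p i.
  apply/rowP => j; rewrite !mxE eqxx/=; have [->|ji] /= := eqVneq j i.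
    by rewrite ltnSn ltnn mulr1 /dl subrK.
  rewrite mulr0 add0r ltnS leq_eqVlt.
  by have -> : (j == i :> nat) = false by exact/negbTE.
rewrite pS mulrC; apply: (@mean_value_dir _ _ f (fun z => dl * partial i f z)).
  by move=> z; apply: is_derive_dirZ; exact: derivableP.
move=> t /andP[t0 t1]; rewrite -mulrBr normrM mulrC ler_wpM2r//.
(* Balls of the max norm are boxes, so a point mixing coordinates of [x] and [y] stays in the
   ball. *)
apply: near_q; apply: le_ball d_le _ _; split; first by case: qx.
move=> i' j; rewrite (ord1 i'); case: qx => _ /(_ ord0 j); case: qy => _ /(_ ord0 j).
rewrite /ball/= !mxE eqxx/=.
have [->|ji] /= := eqVneq j i; last by rewrite !mulr0 add0r; case: ifP.
rewrite ltnn mulr1 /dl.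
move: (q _ _) (x _ _) (y _ _) => q' x' y'; rewrite !ltr_norml.
move=> /andP[? ?] /andP[? ?].
by have [xy|xy] := leP x' y'; apply/andP; split; nra.
Unshelve. all: by end_near. Qed.

End StrictDifferentiability.

(** * Rays leaving a C^2 domain *)

Section Exit.
Context {R : realType} {N : nat}.
Implicit Types (x y z p v : 'rV[R]_N) (Omega : set 'rV[R]_N).

Lemma dot_mulmx x y (Q : 'M[R]_N) : dot x (y *m Q) = dot (x *m Q^T) y.
Proof.
rewrite /dot; under eq_bigr do rewrite mxE mulr_sumr.
rewrite exchange_big/=; apply: eq_bigr => j _; rewrite mxE mulr_suml.
by apply: eq_bigr => i _; rewrite mxE; ring.
Qed.

Lemma enorm_orthogonal x (Q : 'M[R]_N) : Q *m Q^T = 1%:M -> enorm (x *m Q) = enorm x.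
Proof. by move=> QQ; rewrite !enormE dot_mulmx -mulmxA QQ mulmx1. Qed.

Lemma enorm_orthogonal_tr x (Q : 'M[R]_N) :
  Q *m Q^T = 1%:M -> enorm (x *m Q^T) = enorm x.
Proof.
by move=> /mulmx1C QQ; apply: enorm_orthogonal; rewrite trmxK.
Qed.

(* If Omega is locally {F > 0} and F is strictly differentiable at p with
   gradient g, then the ray in direction - g leaves Omega. *)
Lemma exits_near_level_set Omega (F : 'rV[R]_N -> R) g p (r : R) :
  0 < r -> 1 <= enorm g -> F p <= 0 ->
  (forall y, eball p r y -> (Omega y <-> 0 < F y)) ->
  (forall x y, eball p r x -> eball p r y ->
     `|F y - F x - dot g (y - x)| <= 3^-1 * enorm (y - x)) ->
  forall x, Omega x -> enorm (x - p) < r / 8 -> exits Omega x.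
Proof.
move=> r0 g1 Fp OF sd x Ox xp.
have pr : eball p r p by exact: eball_center.
have xr : eball p r x by rewrite /eball/=; lra.
have g0 : 0 < enorm g by lra.
pose xi := - ((enorm g)^-1 *: g).
have xi1 : enorm xi = 1.
  by rewrite enormN enormZ gtr0_norm ?invr_gt0// mulVf ?gt_eqF.
have gxi : dot g xi = - enorm g.
  rewrite dotNr dotZr -sqr_enorm expr2 mulrA mulVf ?gt_eqF// mul1r//.
have Fx : 0 < F x by apply/OF.
have Fx_le : F x <= 4 / 3 * enorm g * enorm (x - p).
  have := sd p x pr xr; rewrite ler_norml => /andP[_].
  have := le_trans (ler_norm _) (dot_le_enorm g (x - p)).
  have := enorm_ge0 (x - p); nra.
(* As [1/3 <= enorm g / 3], [F] falls along [xi] at a rate of at least [2/3 * enorm g], so it is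
   nonpositive from [h] on. It varies at a rate of at most [4/3 * enorm g], so it keeps half of
   [F x] within [h / 4]. *)
pose h := 3 / 2 * (F x / enorm g).
have h0 : 0 < h by rewrite mulr_gt0// divr_gt0.
have hE : h * enorm g = 3 / 2 * F x by rewrite /h -mulrA divfK ?gt_eqF.
have hr : h <= 2 * enorm (x - p).
  by rewrite -(ler_pM2r g0) hE; clear -Fx_le; lra.
exists xi, h; split=> //.
  move=> y; rewrite /eclosed_ball/= => yx.
  have yr : eball p r y.
    rewrite /eball/=; have := enorm_triangle x y p.
    by clear -yx xp hr h0; lra.
  apply/OF => //; have := sd x y xr yr; rewrite ler_norml => /andP[+ _].
  have := dot_le_enorm g (y - x); rewrite ler_norml => /andP[+ _].
  have gy : enorm g * enorm (y - x) <= enorm g * (h / 4) by rewrite ler_pM2l.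
  have gg : 1 * (h / 4) <= enorm g * (h / 4) by rewrite ler_pM2r// divr_gt0.
  by clear -gy gg yx hE Fx; lra.
move=> t /andP[ht t2h].
have t0 : 0 < t by lra.
have yr : eball p r (x + t *: xi).
  rewrite /eball/= addrAC; apply: le_lt_trans (enormD _ _) _.
  by rewrite enormZ xi1 (gtr0_norm t0); clear -t2h hr xp r0; lra.
move=> /OF; move=> /(_ yr); apply/negP; rewrite -leNgt.
have := sd x _ xr yr; rewrite [x + _ - x]addrAC subrr add0r dotZr gxi enormZ xi1.
rewrite (gtr0_norm t0) ler_norml => /andP[_].
have gt : h * enorm g <= t * enorm g by rewrite ler_pM2r.
have gg : t * 1 <= t * enorm g by rewrite ler_pM2l.
by clear -gt gg hE; lra.
Qed.

Lemma exits_near_complement Omega p : open Omega -> C2_boundary Omega -> ~ Omega p ->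
  exists2 r : R, 0 < r & forall x, Omega x -> enorm (x - p) < r -> exits Omega x.
Proof.
(* Off the closure a small ball misses [Omega] and the claim is vacuous. *)
move=> oO C2 Op; have [clp|] := pselect (closure Omega p); last first.
  move=> /existsNP[A /not_implyP[/nbhs_eball[r r0 rA] nA]].
  by exists r => // x Ox xp; exfalso; apply: nA; exists x; split => //; exact: rA.
have bp : boundary Omega p by split => // /interior_subset.
have [r [Q [i [gam [r0 QQ [_ Cgam] chart]]]]] := C2 p bp.
have dgam j (x : 'rV[R]_N.-1) : derivable gam x (delta_mx ord0 j) by apply: (Cgam j).1.
have cgam j : continuous (partial j gam).
  by have [_ [cj _]] := Cgam j; exact/continuous_subspace_setT.
pose F y := (y *m Q) ord0 i - gam (col' i (y *m Q)).
pose q := col' i (p *m Q).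
(* Gradient at [p] of the height [F] above the graph, in rotated coordinates; its entry [1] in the
   graph direction bounds its norm from below. *)
pose g0 : 'rV[R]_N :=
  \row_k (if unlift i k is Some j then - partial j gam q else 1).
have g0E v : dot g0 v = v ord0 i - \sum_j partial j gam q * (col' i v) ord0 j.
  rewrite /dot (bigD1_ord i)//= mxE unlift_none mul1r; congr (_ + _).
  by rewrite -sumrN; apply: eq_bigr => j _; rewrite !mxE liftK mulNr.
have g01 : 1 <= enorm g0.
  rewrite -[1]normr1; apply: le_trans (mxnorm_le_enorm _).
  by apply: le_trans (coord_le_mxnorm _ i); rewrite mxE unlift_none.
(* Summed over the [N.-1] coordinates of the graph, this error stays below the [1/3] allowed by
   [exits_near_level_set]. *)
have e0 : 0 < (3 * (N%:R + 1))^-1 :> R.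
  by rewrite invr_gt0 mulr_gt0// ltr_wpDl.
have [d d0 sd] : exists2 d : R, 0 < d &
    forall x y : 'rV[R]_N.-1, ball q d x -> ball q d y ->
    `|gam y - gam x - \sum_j partial j gam q * (y ord0 j - x ord0 j)| <=
    (3 * (N%:R + 1))^-1 * \sum_j `|y ord0 j - x ord0 j|.
  have near_d := strictly_differentiable q dgam cgam e0.
  near (0 : R)^'+ => d; exists d; first by near: d; exact: nbhs_right_gt.
  by near: d.
have inball y : eball p d y -> ball q d (col' i (y *m Q)).
  move=> yp; split => // i' j; rewrite (ord1 i') /ball/= !mxE.
  apply: le_lt_trans yp; rewrite -(enorm_orthogonal (y - p) QQ).
  apply: le_trans (mxnorm_le_enorm _).
  apply: le_trans (coord_le_mxnorm _ (lift i j)).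
  by rewrite mulmxBl !mxE distrC.
pose r1 := Num.min r d; have r10 : 0 < r1 by rewrite lt_min r0.
have r1r y : eball p r1 y -> eball p r y.
  by rewrite /eball/= lt_min => /andP[].
have r1d y : eball p r1 y -> eball p d y.
  by rewrite /eball/= lt_min => /andP[].
exists (r1 / 8); first by rewrite divr_gt0.
apply: (@exits_near_level_set Omega F (g0 *m Q^T) p r1) => //.
- by rewrite enorm_orthogonal_tr.
- by rewrite leNgt; apply/negP; rewrite subr_gt0 => /(chart p (eball_center _ r0)).
- by move=> y /r1r yr; rewrite subr_gt0; exact: chart.
- move=> x y /r1d/inball qx /r1d/inball qy; rewrite -dot_mulmx g0E mulmxBl.
  have := sd _ _ qx qy; set T := \sum_j _; set W := \sum_j _ => TW.
  rewrite (_ : \sum_j _ = T); last by apply: eq_bigr => j _; rewrite !mxE.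
  rewrite (_ : _ - _ - _ =
    - (gam (col' i (y *m Q)) - gam (col' i (x *m Q)) - T)); last first.
    by rewrite /F !mxE; ring.
  rewrite normrN; apply: le_trans TW _.
  have WN : W <= (N%:R + 1) * enorm (y - x).
    apply: (@le_trans _ _ (\sum_(j < N.-1) enorm (y - x))).
      apply: ler_sum => j _; rewrite -(enorm_orthogonal (y - x) QQ).
      apply: le_trans (mxnorm_le_enorm _).
      apply: le_trans (coord_le_mxnorm _ (lift i j)).
      by rewrite mulmxBl !mxE.
    rewrite sumr_const card_ord -[leLHS]mulr_natl; apply: ler_wpM2r.
      exact: enorm_ge0.
    by rewrite natr1 ler_nat (leq_trans (leq_pred N)).
  rewrite invfM -mulrA ler_pM2l ?invr_gt0//.
  by rewrite ler_pdivrMl ?ltr_wpDl.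
Unshelve. all: by end_near. Qed.

(** Compactness of the relevant part of the complement makes the radii of [exits_near_complement]
    uniform. *)
Lemma exits_uniformly Omega : open Omega -> bounded_set Omega -> C2_boundary Omega ->
  exists2 delta : R, 0 < delta <= 1 & forall x z,
    Omega x -> ~ Omega z -> enorm (x - z) < delta -> exits Omega x.
Proof.
move=> oO [M [_ bO]] C2.
have OM x : Omega x -> enorm x <= N%:R * (`|M| + 1).
  move=> /(bO (`|M| + 1)) xM; apply: le_trans (enorm_le_mxnorm _) _.
  by apply: ler_wpM2l => //; apply: xM; rewrite ltr_pwDr// ler_norm.
set M1 := N%:R * _ in OM.
(* [Omega] lies in the ball of radius [M1], so for [d <= 1] every exterior point within [d] of
   [Omega] belongs to [K]. *)
pose K := eclosed_ball (0 : 'rV[R]_N) (M1 + 1) `&` ~` Omega.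
have cK : compact K.
  apply: subclosed_compact; last exact: subIsetl.
    by apply: closedI; [exact: eclosed_ball_closed|exact: open_closedC].
  exact: eclosed_ball_compact.
have cov : \forall d \near (0 : R)^'+,
    K `<=` (fun z => forall x, Omega x -> enorm (x - z) < d -> exits Omega x).
  have /compact_near_coveringP ncK := cK.
  apply: (ncK _ _ (fun d z => forall x, Omega x -> enorm (x - z) < d -> exits Omega x)).
  move=> z [_ /(exits_near_complement oO C2)[r r0 exr]].
  exists (eball z (r / 2), [set d : R | d <= r / 2]) => /=.
    split; first by apply: nbhs_eballx; rewrite divr_gt0.
    by apply: nbhs_right_le; rewrite divr_gt0.
  move=> [z' d] /= [zz' dr] x Ox xz'; apply: exr => //.
  have := enorm_triangle z' x z; move: zz'; rewrite /eball/=; lra.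
near (0 : R)^'+ => d.
have d0 : 0 < d by near: d; exact: nbhs_right_gt.
have d1 : d <= 1 by near: d; exact: nbhs_right_le.
exists d; first by rewrite d0.
move=> x z Ox Oz xz.
have : K `<=` (fun z => forall x, Omega x -> enorm (x - z) < d -> exits Omega x).
  by near: d.
move=> /(_ z)/(_ _ x Ox xz); apply; split=> //; rewrite /eclosed_ball/= subr0.
have := enormD (z - x) x; rewrite subrK enormBC; have := OM _ Ox; lra.
Unshelve. all: by end_near. Qed.

End Exit.

(** * Dilations *)

Lemma within_continuous_comp (X Y Z : topologicalType) (A : set Y) (g : X -> Y)
    (f : Y -> Z) :
  continuous g -> {within A, continuous f} -> {within g @^-1` A, continuous (f \o g)}.
Proof.
move=> cg /subspace_continuousP cf; apply/subspace_continuousP => x Ax.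
apply: cvg_comp (cf _ Ax) => B /=; rewrite /within/= => /cg.
exact.
Qed.

Section Dilations.
Context {R : realType} {N : nat}.
Variable l : R.
Hypothesis l0 : 0 < l.
Implicit Types (x y z xi : 'rV[R]_N) (U Omega : set 'rV[R]_N) (u f phi : 'rV[R]_N -> R).

Let dil x := l *: x.

Let dilK x : l^-1 *: dil x = x.
Proof. by rewrite scalerA mulVf ?gt_eqF// scale1r. Qed.

Let dilVK x : dil (l^-1 *: x) = x.
Proof. by rewrite /dil scalerA divff ?gt_eqF// scale1r. Qed.

Let continuous_dil : continuous dil.
Proof. exact: scaler_continuous. Qed.

Lemma open_dilation U : open U -> open (dil @^-1` U).
Proof. by apply: open_comp => x _; exact: continuous_dil. Qed.

Lemma closure_dilation U : closure (dil @^-1` U) `<=` dil @^-1` (closure U).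
Proof.
move=> x clx B /continuous_dil /clx[y [Uy By]]; by exists (dil y).
Qed.

Lemma domain_dilation Omega : domain Omega -> domain (dil @^-1` Omega).
Proof.
move=> [[x Ox] oO cO]; split.
- by exists (l^-1 *: x); rewrite /preimage/= dilVK.
- exact: open_dilation.
- rewrite (_ : _ @^-1` _ = [set l^-1 *: y | y in Omega]); last first.
    apply/seteqP; split=> y /=; first by exists (dil y); rewrite ?dilK.
    by move=> [z Oz <-]; rewrite dilVK.
  apply: connected_continuous_connected => //.
  by apply: continuous_subspaceT; exact: scaler_continuous.
Qed.

(** Good sets principle: the sets with Borel preimage under the dilation form a sigma-algebra
    containing the open sets. *)
Lemma borel_dilation u : borel_fun u -> borel_fun (fun x => u (dil x)).
Proof.
move=> bu B mB; have := bu B mB.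
pose S := [set A : set 'rV[R]_N |
  <<s [set A : set 'rV[R]_N | open A] >> (dil @^-1` A)].
suff /(_ (u @^-1` B)) : <<s [set A : set 'rV[R]_N | open A] >> `<=` S by apply.
have [s0 sC sU] := @smallest_sigma_algebra _ setT [set A : set 'rV[R]_N | open A].
apply: smallest_sub; last first.
  by move=> A oA; apply: sub_sigma_algebra; exact: open_dilation.
split; rewrite /S/=.
- by rewrite preimage_set0.
- by move=> A /sC; rewrite !setTD preimage_setC.
- by move=> F /sU; rewrite preimage_bigcup.
Qed.

Lemma admissible_dilation Omega u :
  admissible Omega u -> admissible (dil @^-1` Omega) (fun x => u (dil x)).
Proof.
move=> [[M [Mr bu]] mu cu]; split.
- by exists M; split=> // K /bu uK x _; exact: uK.
- exact: borel_dilation.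
- exact: within_continuous_comp.
Qed.

Lemma is_derive_dilation f x v (d : R) : is_derive (dil x) v f d ->
  is_derive x v (fun y => f (dil y)) (l * d).
Proof.
move=> /(is_derive_dirZ l) /is_derive_cvg fd; apply/is_derive_cvg.
apply: cvg_trans fd; apply: near_eq_cvg; near=> h.
have lh : l *: (h *: v) = h *: (l *: v) by rewrite !scalerA mulrC.
by rewrite /= /dil (scalerDr l) lh.
Unshelve. all: by end_near. Qed.

Lemma within_continuous_dilation (c : R) U phi psi : {within U, continuous phi} ->
  (forall x, U (dil x) -> psi x = c * phi (dil x)) ->
  {within dil @^-1` U, continuous psi}.
Proof.
move=> /(within_continuous_comp continuous_dil) cphi psiE.
have cc : {within dil @^-1` U, continuous (fun x => c * phi (dil x))}.
  by move=> x; exact: (cvgMr (cphi x)).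
apply: (@subspace_eq_continuous _ _ _ (fun x => c * phi (dil x))) cc.
by move=> x /set_mem Ux; exact/esym/psiE.
Qed.

(** Each differentiation brings out a factor [l], and the resulting identity is known on the open
    set only; the free constant [c] and the identity restricted to [U] let the induction pass to
    partial derivatives. *)
Lemma Ck_dilation (k : nat) (c : R) U phi psi : open U -> Ck k U phi ->
  (forall x, U (dil x) -> psi x = c * phi (dil x)) -> Ck k (dil @^-1` U) psi.
Proof.
move=> oU; elim: k c phi psi => [|k IH] c phi psi [cphi Cphi] psiE.
  by split=> //; exact: within_continuous_dilation cphi psiE.
have oV := open_dilation oU.
have near_psi x : U (dil x) -> \near x, c * phi (dil x) = psi x.
  move=> Ux; have : nbhs x (dil @^-1` U) by exact: open_nbhs_nbhs.
  by apply: filterS => y Uy; rewrite psiE.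
have D i x : U (dil x) -> is_derive x (delta_mx ord0 i)
    (fun y => c * phi (dil y)) (c * (l * partial i phi (dil x))).
  move=> Ux; have dphi := (Cphi i).1 _ Ux.
  have := is_derive_dilation (derivableP dphi).
  by move=> /(is_deriveZ c).
split; first exact: within_continuous_dilation cphi psiE.
move=> i; split.
  move=> x Ux; apply: near_eq_derivable (near_psi x Ux) _.
  exact: (@ex_derive _ _ _ _ _ _ _ (D i x Ux)).
apply: (IH (c * l) (partial i phi)); first exact: (Cphi i).2.
move=> x Ux; rewrite -mulrA -(@derive_val _ _ _ _ _ _ _ (D i x Ux)).
by rewrite /partial -(near_eq_derive _ (near_psi x Ux)).
Qed.

Lemma partial_dilation (c : R) U phi psi i x : open U -> U (dil x) ->
  (forall y, U (dil y) -> psi y = c * phi (dil y)) ->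
  derivable phi (dil x) (delta_mx ord0 i) ->
  partial i psi x = c * l * partial i phi (dil x).
Proof.
move=> oU Ux psiE dphi.
have near_psi : \near x, c * phi (dil x) = psi x.
  have : nbhs x (dil @^-1` U) by apply: open_nbhs_nbhs; split=> //; exact: open_dilation.
  by apply: filterS => y Uy; rewrite psiE.
have D : is_derive x (delta_mx ord0 i) (fun y => c * phi (dil y))
    (c * (l * partial i phi (dil x))).
  exact: (is_deriveZ c (is_derive_dilation (derivableP dphi))).
by rewrite /partial -(near_eq_derive _ near_psi) (@derive_val _ _ _ _ _ _ _ D) mulrA.
Qed.

Lemma C2_closure_dilation U phi : open U -> C2_closure U phi ->
  C2_closure (dil @^-1` U) (fun x => phi (dil x)).
Proof.
move=> oU [[cphi Cphi] ccphi ex1 ex2].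
have ext c (g : 'rV[R]_N -> R) h : extends_to_closure U g ->
    (forall x, U (dil x) -> h x = c * g (dil x)) ->
    extends_to_closure (dil @^-1` U) h.
  move=> [gb cgb gbE] hE; exists (fun x => c * gb (dil x)); last first.
    by move=> x Ux; rewrite hE// gbE.
  apply: continuous_subspaceW (@closure_dilation U) _.
  exact: (within_continuous_dilation cgb).
have p1 i x : U (dil x) ->
    partial i (fun x => phi (dil x)) x = l * partial i phi (dil x).
  move=> Ux; rewrite (@partial_dilation 1 U phi)// ?mul1r//.
    by move=> y _; rewrite mul1r.
  by apply: (Cphi i).1.
split.
- apply: (@Ck_dilation 2 1 U phi) => //.
  by move=> x _; rewrite mul1r.
- apply: continuous_subspaceW (@closure_dilation U) _.
  exact: within_continuous_comp continuous_dil ccphi.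
- by move=> i; apply: (ext l _ _ (ex1 i)) => x; exact: p1.
- move=> i j; apply: (ext (l * l) _ _ (ex2 i j)) => x Ux.
  rewrite (@partial_dilation l U (partial j phi))//; first by move=> y; exact: p1.
  by have [_ [_ Cj]] := Cphi j; apply: (Cj i).1.
Qed.

(** Homogeneity of degree [2s]: the kernel gives [l^(1 + 2s)] and the measure takes back one [l].
    The identity is between extended reals, so infinite values are covered. *)
Lemma Idir_dilation (c s : R) xi u x : Idir c s xi (fun y => u (dil y)) x =
  ((l `^ (2 * s))%:E * Idir c s xi u (dil x))%E.
Proof.
have ls0 : 0 < l `^ (2 * s) by rewrite powR_gt0.
pose H t := (u (dil x + t *: xi) + u (dil x - t *: xi) - 2 * u (dil x)) / t `^ (1 + 2 * s).
have HE : (\int[lebesgue_measure]_(t in `]0%R, +oo[)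
    ((u (dil (x + t *: xi)) + u (dil (x - t *: xi)) - 2 * u (dil x)) /
      t `^ (1 + 2 * s))%:E =
    (l `^ (2 * s))%:E * \int[lebesgue_measure]_(t in `]0%R, +oo[) (H t)%:E)%E.
  rewrite (integral_dilation (fun t => (H t)%:E) l0) muleA -EFinM.
  rewrite -integralZl_nonmeasurable ?mulr_gt0//; apply: eq_integral => t.
  rewrite mem_setE in_itv/= andbT => t0; rewrite -EFinM; congr (_%:E).
  rewrite /H /dil scalerDr scalerBr !scalerA (powRM _ (ltW l0) (ltW t0)).
  rewrite [l `^ (1 + _)]powRD; last by rewrite implybE (gt_eqF l0) orbT.
  rewrite (powRr1 (ltW l0)); have T0 : 0 < t `^ (1 + 2 * s) by rewrite powR_gt0.
  move: (u _ + u _ - _) (l `^ _) ls0 (t `^ _) T0 => a ls ls0 T T0.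
  by field; rewrite !gt_eqF.
by rewrite /Idir HE muleCA.
Qed.

Lemma Iop_dilation (c s : R) u x : Iop c s (fun y => u (dil y)) x =
  ((l `^ (2 * s))%:E * Iop c s u (dil x))%E.
Proof.
have ls0 : 0 < l `^ (2 * s) by rewrite powR_gt0.
rewrite /Iop gt0_muleDr// -ereal_inf_pZl// -ereal_sup_pZl//.
suff -> : [set Idir c s xi (fun y => u (dil y)) x | xi in sphere] =
    [set ((l `^ (2 * s))%:E * a)%E | a in [set Idir c s xi u (dil x) | xi in sphere]] by [].
apply/seteqP; split=> [_ [xi sxi <-]|_ [_ [xi sxi <-] <-]]; last first.
  by exists xi => //; rewrite Idir_dilation.
by exists (Idir c s xi u (dil x)); [exists xi|rewrite Idir_dilation].
Qed.

End Dilations.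

(** * Dilation of viscosity solutions *)

Section ViscosityDilation.
Context {R : realType} {N : nat}.
Implicit Types (Omega : set 'rV[R]_N) (u f : 'rV[R]_N -> R).

(** A test function at [x0] with radius [rho] for the dilated problem corresponds to one at
    [l *: x0] with radius [l * rho] for [u], and gluing commutes with this correspondence. *)
Lemma viscosity_dilation (c s l : R) Omega f u : 0 < l ->
  viscosity_solution c s Omega f u ->
  viscosity_solution c s ( *:%R l @^-1` Omega)
    (fun x => l `^ (2 * s) * f (l *: x)) (fun x => u (l *: x)).
Proof.
move=> l0 [[adm sub] [_ sup]].
have ls0 : 0 < l `^ (2 * s) by rewrite powR_gt0.
have li0 : 0 < l^-1 by rewrite invr_gt0.
have adml := admissible_dilation l adm.
have lK (x : 'rV[R]_N) : l^-1 *: (l *: x) = x.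
  by rewrite scalerA mulVf ?gt_eqF// scale1r.
have Kl (x : 'rV[R]_N) : l *: (l^-1 *: x) = x.
  by rewrite scalerA divff ?gt_eqF// scale1r.
have ldist (x x0 : 'rV[R]_N) : enorm (x - l *: x0) = l * enorm (l^-1 *: x - x0).
  by rewrite -{1}(Kl x) -scalerBr enormZ (gtr0_norm l0).
have ballE x0 rho :
    eball (l *: x0) (l * rho) = *:%R l^-1 @^-1` eball x0 rho :> set 'rV[R]_N.
  by apply/seteqP; split=> x; rewrite /eball/= ldist ltr_pM2l.
have glueE x0 rho phi : Defs.glue x0 rho phi (fun x => u (l *: x)) =
    fun x => Defs.glue (l *: x0) (l * rho) (fun x => phi (l^-1 *: x)) u (l *: x).
  by apply/funext => x; rewrite /Defs.glue ldist lK ler_pM2l.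
have key x0 rho phi : (l *: x0) \in Omega -> 0 < rho ->
    eclosed_ball x0 rho `<=` ( *:%R l @^-1` Omega) ->
    C2_closure (eball x0 rho) phi ->
  [/\ Omega (l *: x0), 0 < l * rho, eclosed_ball (l *: x0) (l * rho) `<=` Omega,
     C2_closure (eball (l *: x0) (l * rho)) (fun x => phi (l^-1 *: x)) &
     phi (l^-1 *: (l *: x0)) = phi x0].
  move=> /set_mem Ox0 rho0 ball_O C2; split; first exact: Ox0.
  - by rewrite mulr_gt0.
  - move=> x; rewrite /eclosed_ball/= ldist ler_pM2l// => /ball_O.
    by rewrite /preimage/= Kl.
  - by rewrite ballE; apply: C2_closure_dilation => //; exact: eball_open.
  - by rewrite lK.
split; split=> // x0 rho phi Ox0 rho0 ball_O C2 phix0 phiu;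
  have [Ox0' rho0' ball_O' C2' phiE] := key x0 rho phi (mem_set Ox0) rho0 ball_O C2;
  rewrite glueE Iop_dilation// EFinM lee_pmul2l//.
- apply: sub => //; first by rewrite phiE.
  by move=> x; rewrite ballE => /phiu; rewrite Kl.
- apply: sup => //; first by rewrite phiE.
  by move=> x; rewrite ballE => /phiu; rewrite Kl.
Qed.

End ViscosityDilation.

(** * Interior estimate at all scales *)

Section HolderNorms.
Context {R : realType} {N : nat}.
Implicit Types (A : set 'rV[R]_N) (x y : 'rV[R]_N) (u : 'rV[R]_N -> R).

Lemma holder_norm_bound A (alpha K : R) u x y :
  (holder_norm A alpha u <= K%:E)%E -> A x -> A y -> x <> y ->
  `|u x - u y| <= K * enorm (x - y) `^ alpha.
Proof.
move=> uK Ax Ay xy.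
have xy0 : 0 < enorm (x - y) by rewrite enorm_gt0 subr_eq0; exact/eqP.
rewrite -ler_pdivrMr ?powR_gt0// -lee_fin; apply: le_trans uK.
apply: (@le_trans _ _ (holder_seminorm A alpha u)).
  by apply: ereal_sup_ubound; exists x, y.
apply: leeDr; apply: (@le_trans _ _ `|u x|%:E); first by rewrite lee_fin.
by apply: ereal_sup_ubound; exists x.
Qed.

Lemma holder_of_bound A (alpha M H : R) u :
  (forall x, `|u x| <= M) ->
  (forall x y, `|u x - u y| <= H * enorm (x - y) `^ alpha) -> holder A alpha u.
Proof.
move=> uM uH; apply: (@le_lt_trans _ _ (M + H)%:E); last exact: ltry.
rewrite EFinD; apply: leeD.
  by apply: ge_ereal_sup => _ [x _ <-]; rewrite lee_fin.
apply: ge_ereal_sup => _ [x [y [_ _ xy ->]]]; rewrite lee_fin.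
have xy0 : 0 < enorm (x - y) by rewrite enorm_gt0 subr_eq0; exact/eqP.
by rewrite ler_pdivrMr ?powR_gt0.
Qed.

Lemma edist_eball_boundary x (r r' : R) :
  ((r' - r)%:E <= Defs.edist (eball x r) (boundary (eball x r')))%E.
Proof.
apply/ereal_infP => _ [y [z [yr [_ zr] ->]]]; rewrite lee_fin.
have : r' <= enorm (z - x).
  rewrite leNgt; apply/negP => zx; apply: zr; apply: open_nbhs_nbhs.
  by split; [exact: eball_open|].
have := enorm_triangle y z x; rewrite (enormBC z y).
by move: yr; rewrite /eball/=; lra.
Qed.

Lemma compactly_contained_eball x (r : R) A :
  eclosed_ball x r `<=` A -> compactly_contained (eball x r) A.
Proof.
move=> rA; split; first exact: compact_closure_eball.
exact: subset_trans (@closure_eball _ _ x r) rA.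
Qed.

End HolderNorms.

Section InteriorEstimate.
Context {R : realType} {N : nat}.

Definition interior_estimate (c s alpha : R) : Prop := forall d Mu Mf : R, 0 < d ->
  exists2 K : R, 0 < K &
  forall (D omega omega' : set 'rV[R]_N) (f u : 'rV[R]_N -> R),
    domain D -> {within D, continuous f} -> viscosity_solution c s D f u ->
    open omega -> open omega' ->
    compactly_contained omega omega' -> compactly_contained omega' D ->
    (d%:E <= Defs.edist omega (boundary omega'))%E ->
    (sup_norm setT u <= Mu%:E)%E -> (sup_norm omega' f <= Mf%:E)%E ->
    (holder_norm omega alpha u <= K%:E)%E.

(** Dilation turns the ball of radius [l] into a unit ball. As [l <= 1], the new right-hand side,
    multiplied by [l^(2s)], keeps the bound [Mf], so one [K] serves all scales. *)
Lemma interior_estimate_scaled (c s alpha M Mf : R) : interior_estimate c s alpha ->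
  0 < s -> exists2 K : R, 0 < K &
  forall (Omega : set 'rV[R]_N) (f u : 'rV[R]_N -> R),
    domain Omega -> {within Omega, continuous f} ->
    (forall x, Omega x -> `|f x| <= Mf) -> (forall x, `|u x| <= M) ->
    viscosity_solution c s Omega f u ->
    forall (l : R) x y, 0 < l <= 1 -> eclosed_ball x l `<=` Omega ->
    enorm (x - y) <= l / 4 -> `|u x - u y| <= K * (enorm (x - y) / l) `^ alpha.
Proof.
(* [1/4] is the gap between the concentric balls of radii [1/2] and [3/4] used inside the unit
   ball. *)
move=> est s0; have [|K K0 estK] := est 4^-1 M Mf; first by rewrite invr_gt0.
exists K => // Omega f u dO cf fM uM vu l x y /andP[l0 l1] ballO xy.
have [->|/eqP xneqy] := eqVneq x y.
  by rewrite !subrr normr0 mulr_ge0 ?powR_ge0// ltW.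
have lV (v : 'rV[R]_N) : l *: (l^-1 *: v) = v.
  by rewrite scalerA divff ?gt_eqF// scale1r.
have ldist (v w : 'rV[R]_N) : enorm (l^-1 *: v - l^-1 *: w) = enorm (v - w) / l.
  by rewrite -scalerBr enormZ gtr0_norm ?invr_gt0// mulrC.
have ball_l (v : 'rV[R]_N) (r : R) : r <= 1 ->
    eclosed_ball (l^-1 *: x) r v -> Omega (l *: v).
  move=> r1 vr; apply: ballO; rewrite /eclosed_ball/= in vr *.
  rewrite -[x]lV -scalerBr enormZ (gtr0_norm l0).
  by rewrite -[leRHS]mulr1 ler_pM2l// (le_trans vr).
have := @holder_norm_bound _ _ (eball (l^-1 *: x) 2^-1) alpha K
  (fun v => u (l *: v)) (l^-1 *: x) (l^-1 *: y).
rewrite !lV ldist; apply.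
- apply: (estK ( *:%R l @^-1` Omega) _ (eball (l^-1 *: x) (3 / 4))
    (fun v => l `^ (2 * s) * f (l *: v))).
  + exact: domain_dilation.
  + apply: (@within_continuous_dilation _ _ l (l `^ (2 * s)) Omega f) => //.
  + exact: viscosity_dilation.
  + exact: eball_open.
  + exact: eball_open.
  + apply: compactly_contained_eball => v; rewrite /eclosed_ball /eball/=; lra.
  + apply: compactly_contained_eball => v; apply: ball_l; lra.
  + apply: le_trans (edist_eball_boundary _ _ _).
    by rewrite lee_fin; lra.
  + by apply: ge_ereal_sup => _ [v _ <-]; rewrite lee_fin.
  + apply: ge_ereal_sup => _ [v vr <-]; rewrite lee_fin normrM.
    rewrite ger0_norm ?powR_ge0//.
    have fMv : `|f (l *: v)| <= Mf.
      apply: fM; apply: (@ball_l _ (3 / 4)); first by lra.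
      by move: vr; rewrite /eball /eclosed_ball/=; exact: ltW.
    apply: le_trans fMv; rewrite -[leRHS]mul1r ler_wpM2r//.
    apply: (@le_trans _ _ (1 `^ (2 * s))); last by rewrite powR1.
    apply: ge0_ler_powR => //.
    * by rewrite mulr_ge0// ltW.
    * by rewrite nnegrE ltW.
    * by rewrite nnegrE.
- by apply: eball_center; rewrite invr_gt0.
- rewrite /eball/= ldist enormBC ltr_pdivrMr//; lra.
- by move=> /(congr1 ( *:%R l)); rewrite !lV.
Qed.

End InteriorEstimate.

(** * Two-sided boundary decay and global Hölder bound *)

Section Conclusion.
Context {R : realType} {N : nat}.

(** [b] is fixed before [Omega] and the data because its smallness involves [J] only, hence [s];
    these affect only [C]. Both signs come from [barrier], applied to [u] and to [- u]. *)
Lemma boundary_estimate (c s : R) : 0 < c -> 2^-1 < s < 1 ->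
  exists2 b : R, 0 < b <= 2^-1 &
  forall (Omega : set 'rV[R]_N) (f u : 'rV[R]_N -> R) (M K : R),
    open Omega -> bounded_set Omega -> C2_boundary Omega ->
    (forall x, `|u x| <= M) -> (forall x, Omega x -> `|f x| <= K) -> 0 <= K ->
    viscosity_solution c s Omega f u -> (forall x, ~ Omega x -> u x = 0) ->
    exists2 C : R, 0 < C &
      forall x z, ~ Omega z -> `|u x| <= C * enorm (x - z) `^ b.
Proof.
move=> c0 hs; have [J J0 hJ] := integral_qlin hs.
pose b := Num.min 2^-1 (10368%:R^-1 / (8 * J)).
have b0 : 0 < b by rewrite lt_min invr_gt0 ltr0n divr_gt0 ?mulr_gt0// invr_gt0.
have b2 : b <= 2^-1 by rewrite ge_min lexx.
have Jb : 8 * J * b <= 10368%:R^-1.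
  by rewrite mulrC -ler_pdivlMr ?mulr_gt0// ge_min lexx orbT.
exists b; first by rewrite b0.
move=> Omega f u M K oO bO C2 uM fK K0 [sub sup] u0.
have [d /andP[d0 d1] ex] := exits_uniformly oO bO C2.
have [[_ _ cu] _] := sub.
have [C C0 uC] := barrier c0 hs J0 K0 b0 b2 Jb
  (subsolution_touching_bound c0 hs hJ fK sub) cu uM u0 d0 d1 ex.
have cuN : {within Omega, continuous (\- u)} by move=> x; exact: (cvgN (cu x)).
have uNM x : `|(\- u) x| <= M by rewrite /= normrN.
have u0N x : ~ Omega x -> (\- u) x = 0 by move=> /u0 /= ->; rewrite oppr0.
have [C' C'0 uC'] := barrier c0 hs J0 K0 b0 b2 Jb
  (supersolution_touching_bound c0 hs hJ fK sup) cuN uNM u0N d0 d1 ex.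
exists (C + C'); first by rewrite addr_gt0.
move=> x z zO; have := uC x z zO; have /= := uC' x z zO.
have : 0 <= C * enorm (x - z) `^ b by rewrite mulr_ge0 ?powR_ge0// ltW.
have : 0 <= C' * enorm (x - z) `^ b by rewrite mulr_ge0 ?powR_ge0// ltW.
by rewrite mulrDl ler_norml => *; apply/andP; split; lra.
Qed.

(* Comparing the interior estimate in the ball of radius l = sqrt r around x
   with the boundary estimate handles two points at distance r. *)
Lemma interpolate_estimates (Omega : set 'rV[R]_N) (u : 'rV[R]_N -> R)
    (a b M K C : R) :
  0 < a < 1 -> 0 < b <= 2^-1 -> 0 < K -> 0 < C -> (forall x, `|u x| <= M) ->
  (forall x z, ~ Omega z -> `|u x| <= C * enorm (x - z) `^ b) ->
  (forall (l : R) x y, 0 < l <= 1 -> eclosed_ball x l `<=` Omega ->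
     enorm (x - y) <= l / 4 -> `|u x - u y| <= K * (enorm (x - y) / l) `^ a) ->
  forall x y,
    `|u x - u y| <= (32 * M + K + 3 * C) * enorm (x - y) `^ (Num.min a b / 2).
Proof.
move=> /andP[a0 a1] /andP[b0 b2] K0 C0 uM uC uK x y.
have M0 : 0 <= M by apply: le_trans (uM 0); exact: normr_ge0.
pose e := Num.min a b / 2.
have e0 : 0 < e by rewrite divr_gt0// lt_min a0.
have ea : e <= a / 2 by rewrite ler_pM2r ?invr_gt0// ge_min lexx.
have eb : e <= b / 2 by rewrite ler_pM2r ?invr_gt0// ge_min lexx orbT.
set r := enorm (x - y); have r0 : 0 <= r by exact: enorm_ge0.
have [rE|rneq0] := eqVneq r 0.
  have /enorm_eq0/eqP := rE; rewrite subr_eq0 => /eqP ->.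
  by rewrite subrr normr0 mulr_ge0 ?powR_ge0//; lra.
have {rneq0}r0' : 0 < r by rewrite lt_def rneq0.
rewrite !mulrDl -/e; set re := r `^ e; have re0 : 0 < re by rewrite powR_gt0.
have Mre : 0 <= 32 * M * re by rewrite mulr_ge0 ?mulr_ge0// ltW.
have Kre : 0 <= K * re by rewrite mulr_ge0 ?ltW.
have Cre : 0 <= 3 * C * re by rewrite mulr_ge0 ?mulr_ge0// ltW.
(* For [r >= 1/16] the trivial bound [2 * M] suffices because [16 * r^e >= 1], whence the constant
   32. Below, [l < 1/4] gives [r = l^2 <= l / 4], as the interior estimate asks. *)
have [r16|r16] := leP 16^-1 r.
  have re16 : 16^-1 <= re.
    apply: (@le_trans _ _ (16^-1 `^ e)).
      apply: ger1_powR; last by lra.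
      by rewrite invr_gt0 ltr0n invf_le1 ?ler1n.
    by apply: ge0_ler_powR; rewrite ?nnegrE ?(ltW e0)// ?invr_ge0.
  have : M / 16 <= M * re by rewrite ler_wpM2l.
  have := le_trans (ler_normB (u x) (u y)) (lerD (uM x) (uM y)).
  by clear -Mre Kre Cre; lra.
have r1 : r <= 1 by lra.
pose l := Num.sqrt r; have l0 : 0 < l by rewrite sqrtr_gt0.
have ll : l * l = r by rewrite -expr2 sqr_sqrtr.
have l4 : l < 4^-1.
  by rewrite -ltr_sqr ?nnegrE ?(ltW l0)// expr2 ll; lra.
have rl : r <= l / 4 by rewrite -ll ler_pM2l// ltW.
(* [l^q = r^(q/2)], which is why the exponent is halved. *)
have lpow q : e <= q / 2 -> l `^ q <= re.
  move=> eq2; rewrite /l -powR12_sqrt// -powRrM mulrC.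
  by apply: ger_powR => //; rewrite r0'.
have [ballO|] := pselect (eclosed_ball x l `<=` Omega).
  have := uK l x y; rewrite l0 -/r => /(_ _ ballO rl)/wrap[]; first by lra.
  rewrite -ll mulfK ?gt_eqF//.
  have : K * l `^ a <= K * re by rewrite ler_pM2l// lpow.
  by clear -Mre Cre; lra.
(* The exterior point [z] is within [l] of [x] and [2 * l] of [y]; as [2^b <= 2], the two boundary
   bounds add up to [3 * C * l^b]. *)
move=> /existsNP[z /not_implyP[zl zO]].
have xz : enorm (x - z) <= l by rewrite enormBC.
have yz : enorm (y - z) <= 2 * l.
  apply: le_trans (enorm_triangle x y z) _; rewrite enormBC -/r.
  by clear -xz rl l0; lra.
have ux : `|u x| <= C * l `^ b.
  apply: le_trans (uC x z zO) _; rewrite (ler_pM2l C0).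
  by apply: ge0_ler_powR; rewrite ?nnegrE ?enorm_ge0 ?(ltW b0) ?(ltW l0).
have uy : `|u y| <= C * (2 * l `^ b).
  apply: le_trans (uC y z zO) _; rewrite (ler_pM2l C0).
  apply: (@le_trans _ _ ((2 * l) `^ b)).
    by apply: ge0_ler_powR; rewrite ?nnegrE ?enorm_ge0 ?(ltW b0) ?mulr_ge0 ?(ltW l0).
  rewrite (powRM _ (ler0n _ 2) (ltW l0)) ler_wpM2r ?powR_ge0//.
  by apply: ler1_powR; rewrite ?ler1n//; lra.
have : C * l `^ b <= C * re by rewrite ler_pM2l// lpow.
have := le_trans (ler_normB (u x) (u y)) (lerD ux uy).
by clear -Mre Kre; lra.
Qed.

End Conclusion.

Theorem theorem1p2 (R : realType) (N : nat) (Cs : R -> R) (s0 : R)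
  (hN : (0 < N)%N)
  (hCs : @normalizing R N Cs)
  (hs0 : 2^-1 < s0 < 1)
  (hreg : @interior_holder_bound R N Cs s0)
  (s : R) (hs : s0 < s < 1) :
  exists2 alpha : R, 0 < alpha < 1 &
    forall (Omega : set 'rV[R]_N) (f u : 'rV[R]_N -> R),
      domain Omega -> bounded_set Omega -> C2_boundary Omega ->
      {within Omega, continuous f} -> [bounded f x | x in Omega] ->
      viscosity_solution (Cs s) s Omega f u ->
      (forall x, ~ Omega x -> u x = 0) ->
      holder (closure Omega) alpha u.
Proof.
case/andP: hs0 => s0_gt _; case/andP: (hs) => s0s s1.
have s2 : 2^-1 < s < 1 by rewrite (lt_trans s0_gt s0s).
have s_gt0 : 0 < s by case/andP: s2; lra.
have c0 : 0 < Cs s by apply: hCs.1; rewrite s_gt0.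
have [a a01 [_ est]] := hreg s hs.
have [b b01 bdry] := @boundary_estimate R N _ _ c0 s2.
(* Both [a] and [b] are obtained before [Omega], [f] and [u] are introduced, so the exponent is
   independent of them. *)
exists (Num.min a b / 2).
  case/andP: a01 => a0 a1; case/andP: b01 => b0 b2.
  rewrite divr_gt0 ?lt_min ?a0// ltr_pdivrMr// mul1r gt_min.
  by apply/orP; left; lra.
move=> Omega f u dO bO C2 cf [Kf [_ fK]] vu u0.
have [[[[M [_ uM]] _ _] _] _] := vu.
(* Boundedness provides the estimate for every constant strictly above [M], hence the [+ 1]. *)
have uM' x : `|u x| <= `|M| + 1 by apply: uM => //; rewrite ltr_pwDr// ler_norm.
have fK' x : Omega x -> `|f x| <= `|Kf| + 1.
  by move=> Ox; apply: fK => //; rewrite ltr_pwDr// ler_norm.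
have K0 : 0 <= `|Kf| + 1 by rewrite addr_ge0.
have [_ oO _] := dO.
have [C C0 uC] := bdry Omega f u _ _ oO bO C2 uM' fK' K0 vu u0.
have [K K0' uK] := interior_estimate_scaled (`|M| + 1) (`|Kf| + 1) est s_gt0.
have uH := interpolate_estimates a01 b01 K0' C0 uM' uC (uK _ _ _ dO cf fK' uM' vu).
exact: holder_of_bound uM' uH.
Qed.
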